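(* Let $k$ be a perfect field of characteristic $p>0$ and let $F\in k\llbracket X,Y\rrbracket$ be a (one-dimensional) formal group law over $k$. If $\mathrm{ht}(F)\neq 1$ and $\mathrm{ht}(F)\neq\infty$, then there is an $F[1]$-derivation on the projective line $\mathbb{P}^1=\mathbb{P}^1_k$ which does not expand to an $F$-derivation on $\mathbb{P}^1$.
   Context: A formal group law over $k$ is a power series $F\in k\llbracket X,Y\rrbracket$ with $F(X,0)=X=F(0,X)$ and $F(F(X,Y),Z)=F(X,F(Y,Z))$. For $m>0$, $F[m]$ denotes the image of $F$ in $k[v,w]=k[X,Y]/(X^{p^m},Y^{p^m})$. Height: let $[p]_F(X)\in k\llbracket X\rrbracket$ be the $p$-fold $F$-sum of $X$ with itself. If $[p]_F=0$, then $\mathrm{ht}(F)=\infty$; otherwise $\mathrm{ht}(F)$ is the unique integer $h\geq 1$ such that $[p]_F(X)=g(X^{p^h})$ with $g\in k\llbracket X\rrbracket$, $g(0)=0$, $g'(0)\neq 0$. Let $R$ be a commutative $k$-algebra. An $F$-derivation on $R$ (over $k$) is a sequence $(\partial_n:R\to R)_{n\in\mathbb{N}}$ such that $\partial_0=\mathrm{id}_R$, the map $R\to R\llbracket X\rrbracket$, $r\mapsto\sum_n\partial_n(r)X^n$, is a $k$-algebra homomorphism, and for every $r\in R$ $$\sum_{i,j\ge 0}\partial_i(\partial_j(r))X^iY^j=\sum_{n\ge 0}\partial_n(r)F(X,Y)^n .$$ An $F[m]$-derivation on $R$ (over $k$) is a sequence $(\partial_n:R\to R)_{n<p^m}$ such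 that $\partial_0=\mathrm{id}_R$, the map $R\to R[X]/(X^{p^m})$, $r\mapsto \sum_{n<p^m}\partial_n(r)X^n$, is a $k$-algebra homomorphism, and for every $r\in R$ the equality $\sum_{i,j<p^m}\partial_i(\partial_j(r))v^iw^j=\sum_{n<p^m}\partial_n(r)F[m](v,w)^n$ holds in $R[v,w]=R[X,Y]/(X^{p^m},Y^{p^m})$. An $F$-derivation (resp. $F[m]$-derivation) on $\mathbb{P}^1$ is an $F$-derivation (resp. $F[m]$-derivation) over $k$ on the structure sheaf of $\mathbb{P}^1$. Equivalently, it is an $F$-derivation (resp. $F[m]$-derivation) on $k[t]$ whose unique extension to $k(t)$ preserves the subalgebra $k[1/t]$. An $F[m]$-derivation $(\partial_n)_{n<p^m}$ on $\mathbb{P}^1$ expands to an $F$-derivation on $\mathbb{P}^1$ if there is an $F$-derivation $(D_n)_{n\in\mathbb{N}}$ on $\mathbb{P}^1$ with $D_n=\partial_n$ for all $n<p^m$. *)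

(* Defs.v *)
From HB Require Import structures.
From mathcomp Require Import all_boot all_order all_algebra.

Set Implicit Arguments.
Unset Strict Implicit.
Unset Printing Implicit Defensive.

Import GRing.Theory.
Local Open Scope ring_scope.

(* Power series are given by their coefficients: [f n] is the coefficient of
   X^n and [F i j] that of X^i Y^j. Equality of series is pointwise. *)
Definition ps1 (R : Type) := nat -> R.
Definition ps2 (R : Type) := nat -> nat -> R.

(* R[v,w] = R[X,Y]/(X^q,Y^q), in the basis v^i w^j, i, j < q. *)
Definition tps2 (R : Type) (q : nat) := 'I_q -> 'I_q -> R.

Section PowerSeries.
Variable R : comNzRingType.

Definition mul1 (f g : ps1 R) : ps1 R :=
  fun n => \sum_(i < n.+1) f i * g (n - i)%N.
Definition const1 (c : R) : ps1 R := fun n => if n == 0%N then c else 0.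
Definition var1 : ps1 R := fun n => (n == 1%N)%:R.
Definition pow1 (f : ps1 R) (e : nat) : ps1 R := iter e (mul1 f) (const1 1).

Definition mul2 (F G : ps2 R) : ps2 R := fun a b =>
  \sum_(i < a.+1) \sum_(j < b.+1) F i j * G (a - i)%N (b - j)%N.
Definition one2 : ps2 R := fun a b => ((a == 0%N) && (b == 0%N))%:R.
Definition pow2 (F : ps2 R) (e : nat) : ps2 R := iter e (mul2 F) one2.

(* F(g(X), h(X)), meaningful when g and h have no constant term: then
   g^i h^j has order at least i + j, so the terms left out do not contribute
   to the coefficient of X^n. *)
Definition comp2 (F : ps2 R) (g h : ps1 R) : ps1 R := fun n =>
  \sum_(i < n.+1) \sum_(j < n.+1) F i j * mul1 (pow1 g i) (pow1 h j) n.

(* g(X^q), for q > 0. *)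
Definition subst_exp (g : ps1 R) (q : nat) : ps1 R :=
  fun n => if (q %| n)%N then g (n %/ q)%N else 0.

(* Coefficients of X^a Y^b Z^c in F(F(X,Y),Z) = \sum_n,c F_{n,c} F(X,Y)^n Z^c
   and in F(X,F(Y,Z)) = \sum_a,n F_{a,n} X^a F(Y,Z)^n. When F has no constant
   term, F^n has order at least n, hence the bounds on n. *)
Definition assoc_left (F : ps2 R) (a b c : nat) : R :=
  \sum_(n < (a + b).+1) F n c * pow2 F n a b.
Definition assoc_right (F : ps2 R) (a b c : nat) : R :=
  \sum_(n < (b + c).+1) F a n * pow2 F n b c.

Record formal_group_law (F : ps2 R) : Prop := FormalGroupLaw {
  fgl_unitr : forall i, F i 0%N = var1 i;
  fgl_unitl : forall j, F 0%N j = var1 j;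
  fgl_assoc : forall a b c, assoc_left F a b c = assoc_right F a b c
}.

Definition fgl_nfold (F : ps2 R) (m : nat) : ps1 R :=
  iter m (fun g => comp2 F g var1) (const1 0).

(* [has_height p F h] says that ht(F) = h, with [None] standing for infinity. *)
Definition has_height (p : nat) (F : ps2 R) (h : option nat) : Prop :=
  match h with
  | None => fgl_nfold F p =1 const1 0
  | Some h => ~ (fgl_nfold F p =1 const1 0) /\ (1 <= h)%N /\
      exists g : ps1 R, [/\ g 0%N = 0, g 1%N != 0
        & fgl_nfold F p =1 subst_exp g (p ^ h)]
  end.

Variable q : nat.

Definition trunc2 (F : ps2 R) : tps2 R q := fun i j => F i j.
Definition tmul2 (F G : tps2 R q) : tps2 R q := fun a b =>
  \sum_(i : 'I_q * 'I_q | (i.1 + i.2 == a)%N)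
    \sum_(j : 'I_q * 'I_q | (j.1 + j.2 == b)%N) F i.1 j.1 * G i.2 j.2.
Definition tone2 : tps2 R q :=
  fun a b => ((a == 0%N :> nat) && (b == 0%N :> nat))%:R.
Definition tpow2 (F : tps2 R q) (e : nat) : tps2 R q := iter e (tmul2 F) tone2.

End PowerSeries.

Section Derivations.
(* A commutative k-algebra is a commutative ring R with its structure morphism
   iota; a k-algebra morphism is a ring morphism compatible with these. *)
Variables (k : fieldType) (R : comNzRingType) (iota : {rmorphism k -> R}).

(* In [fder_iter] both sides are compared at X^i Y^j; F^n has order at least n
   since F has no constant term, hence the bound on n. *)
Record Fderivation (F : ps2 k) (D : nat -> R -> R) : Prop := FDerivation {
  fder_id : D 0%N =1 id;
  fder_add : forall r s n, D n (r + s) = D n r + D n s;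
  fder_mul : forall r s n, D n (r * s) = mul1 (D^~ r) (D^~ s) n;
  fder_const : forall c n, D n (iota c) = const1 (iota c) n;
  fder_iter : forall r i j,
    D i (D j r) = \sum_(n < (i + j).+1) D n r * iota (pow2 F n i j)
}.

Record Fmderivation (p m : nat) (F : ps2 k) (d : 'I_(p ^ m) -> R -> R) : Prop :=
  FmDerivation {
  fmder_id : forall n : 'I_(p ^ m), n = 0%N :> nat -> d n =1 id;
  fmder_add : forall r s n, d n (r + s) = d n r + d n s;
  fmder_mul : forall r s n, d n (r * s) =
    \sum_(i : 'I_(p ^ m) * 'I_(p ^ m) | (i.1 + i.2 == n)%N) d i.1 r * d i.2 s;
  fmder_const : forall c n, d n (iota c) = if n == 0%N :> nat then iota c else 0;
  fmder_iter : forall r i j, d i (d j r) =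
    \sum_(n < (p ^ m)%N) d n r * iota (tpow2 (@trunc2 k (p ^ m) F) n i j)
}.

End Derivations.

Section ProjectiveLine.
Variable k : fieldType.

(* k(t) as a k-algebra. *)
Definition ratfun_const : {rmorphism k -> {fraction {poly k}}} :=
  (@tofrac {poly k} \o polyC)%FUN.

(* The subalgebra k[1/t] of k(t). *)
Definition poly_inv_t (f : {fraction {poly k}}) : Prop :=
  exists g : {poly k}, f = (map_poly ratfun_const g).[(tofrac 'X)^-1].

(* Derivations of the structure sheaf of P^1, given by their restriction to
   k[t]; the extension E to k(t) is unique when it exists. *)
Definition Fderivation_P1 (F : ps2 k) (D : nat -> {poly k} -> {poly k}) : Prop :=
  Fderivation polyC F D /\
  exists E : nat -> {fraction {poly k}} -> {fraction {poly k}},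
    [/\ Fderivation ratfun_const F E,
        forall n f, E n (tofrac f) = tofrac (D n f)
      & forall n f, poly_inv_t f -> poly_inv_t (E n f)].

Definition Fmderivation_P1 (p m : nat) (F : ps2 k)
    (d : 'I_(p ^ m) -> {poly k} -> {poly k}) : Prop :=
  Fmderivation polyC F d /\
  exists e : 'I_(p ^ m) -> {fraction {poly k}} -> {fraction {poly k}},
    [/\ Fmderivation ratfun_const F e,
        forall n f, e n (tofrac f) = tofrac (d n f)
      & forall n f, poly_inv_t f -> poly_inv_t (e n f)].

Definition expands_P1 (p m : nat) (F : ps2 k)
    (d : 'I_(p ^ m) -> {poly k} -> {poly k}) : Prop :=
  exists D : nat -> {poly k} -> {poly k},
    Fderivation_P1 F D /\ forall n : 'I_(p ^ m), D n =1 d n.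

End ProjectiveLine.

(* Main.v *)
Require Import Defs.
From HB Require Import structures.
From mathcomp Require Import all_boot all_order all_algebra.
From mathcomp Require Import boolp ring.
Set Implicit Arguments.
Unset Strict Implicit.
Unset Printing Implicit Defensive.
Import GRing.Theory.
Local Open Scope ring_scope.

(** Vector fields on the line with zero p-th power correspond to F[1]-derivations
    once the X^p-coefficient of [p]_F vanishes, i.e. once ht(F) <> 1: then F has
    a logarithm l modulo (X^p, Y^p), and exp(l(X) d/dt) is an F[1]-derivation.
    Suppose that it expands to an F-derivation (D_n). F is commutative to first
    order, so D_1 = d/dt commutes with every D_n. As d/dt vanishes at
    infinity, the point at infinity is fixed, so D_n t is affine in t, and even
    constant since d/dt kills it. These constants form an additive coordinate
    on F, hence [p]_F = 0 and ht(F) is infinite. *)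

(** * The ring of power series *)

(** Commutativity of F is not among the axioms, so the commutation of D_1 with D_n has to be earned:
    it amounts to the equality of the partial derivatives F_X(0,T) and F_Y(T,0). By associativity
    their quotient is a multiplicative character of F, and such a character is analysed by descent
    along the Frobenius twists of F.

    The logarithm comes from integrating the invariant differential. This is possible only below
    degree p, and it makes the invariant derivative of l equal to 1 modulo X^(p-1), one coefficient
    short of what additivity modulo (X^p, Y^p) requires. Up to a factor (p-1)! the missing
    coefficient is the coefficient of X^p in [p]_F, the Hasse invariant. It is read off the p-th
    finite difference of n |-> f([n]_F), which in characteristic p collapses to f([p]_F) - f(0).

    For the converse, d/dt kills every polynomial in t^p, so commutation with d/dt alone does not
    make D_n t constant; the bound on its degree has to come from the point at infinity. *)

Definition series (R : Type) : Type := nat -> R.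

HB.instance Definition _ (R : Type) := gen_eqMixin (series R).
HB.instance Definition _ (R : Type) := gen_choiceMixin (series R).

Section SeriesRing.
Variable R : comNzRingType.
Implicit Types f g h : series R.

Definition trunc (n : nat) f : {poly R} := \poly_(i < n) f i.

Lemma coef_trunc n f i : (trunc n f)`_i = if (i < n)%N then f i else 0.
Proof. by rewrite coef_poly. Qed.

Lemma mul1_trunc n f g i : (i < n)%N ->
  mul1 f g i = (trunc n f * trunc n g)`_i.
Proof.
move=> lt_in; rewrite coefM; apply: eq_bigr => j _.
rewrite !coef_trunc (leq_ltn_trans (leq_subr _ _) lt_in).
by rewrite (leq_ltn_trans _ lt_in) // -ltnS.
Qed.

Lemma eq_coefM n (p q p' q' : {poly R}) :
    (forall i, (i < n)%N -> p`_i = p'`_i) ->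
    (forall i, (i < n)%N -> q`_i = q'`_i) ->
  forall i, (i < n)%N -> (p * q)`_i = (p' * q')`_i.
Proof.
move=> eqp eqq i lt_in; rewrite !coefM; apply: eq_bigr => j _.
by rewrite eqp ?eqq ?(leq_ltn_trans _ lt_in) ?leq_subr // -ltnS.
Qed.

Lemma trunc_mul1 n f g i : (i < n)%N ->
  (trunc n (mul1 f g))`_i = (trunc n f * trunc n g)`_i.
Proof. by move=> lt_in; rewrite coef_trunc lt_in (mul1_trunc _ _ lt_in). Qed.

Let add f g : series R := fun n => f n + g n.
Let opp f : series R := fun n => - f n.
Let zero : series R := fun=> 0.
Let one : series R := const1 1.

Fact series_addA : associative add.
Proof. by move=> f g h; apply/funext => n; rewrite /add addrA. Qed.
Fact series_addC : commutative add.
Proof. by move=> f g; apply/funext => n; rewrite /add addrC. Qed.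
Fact series_add0 : left_id zero add.
Proof. by move=> f; apply/funext => n; rewrite /add add0r. Qed.
Fact series_addN : left_inverse zero opp add.
Proof. by move=> f; apply/funext => n; rewrite /add addNr. Qed.

HB.instance Definition _ := GRing.isZmodule.Build (series R)
  series_addA series_addC series_add0 series_addN.

Fact series_mulA : associative (@mul1 R : series R -> series R -> series R).
Proof.
move=> f g h; apply/funext => n; rewrite !(mul1_trunc _ _ (ltnSn n)).
transitivity ((trunc n.+1 f * (trunc n.+1 g * trunc n.+1 h))`_n).
  by apply: eq_coefM (ltnSn n) => // i lt_in; rewrite trunc_mul1.
rewrite mulrA; apply/esym; apply: eq_coefM (ltnSn n) => // i lt_in.
by rewrite trunc_mul1.
Qed.

Fact series_mulC : commutative (@mul1 R : series R -> series R -> series R).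
Proof.
by move=> f g; apply/funext => n; rewrite !(mul1_trunc _ _ (ltnSn n)) mulrC.
Qed.

Fact series_mul1 : left_id one (@mul1 R).
Proof.
move=> f; apply/funext => n; rewrite /mul1 big_ord_recl big1 ?addr0 ?subn0.
  by rewrite /one /const1 /= mul1r.
by move=> i _; rewrite /one /const1 /= mul0r.
Qed.

Fact series_mulD : left_distributive (@mul1 R : series R -> series R -> series R) +%R.
Proof.
move=> f g h; apply/funext => n.
rewrite /mul1 /GRing.add /= /add -big_split /=.
by apply: eq_bigr => i _; rewrite mulrDl.
Qed.

Fact series_1neq0 : one != 0.
Proof.
apply/eqP => /(congr1 (@^~ 0%N)); rewrite /one /const1 /= => /eqP.
by rewrite (negPf (oner_neq0 R)).
Qed.

HB.instance Definition _ := GRing.Zmodule_isComNzRing.Build (series R)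
  series_mulA series_mulC series_mul1 series_mulD series_1neq0.

Lemma seriesD f g n : (f + g) n = f n + g n. Proof. by []. Qed.
Lemma series0 n : (0 : series R) n = 0. Proof. by []. Qed.
Lemma series1 n : (1 : series R) n = (n == 0%N)%:R.
Proof. by rewrite [LHS]/(const1 1 n) /const1; case: eqP. Qed.
Lemma seriesM f g n : (f * g) n = \sum_(i < n.+1) f i * g (n - i)%N.
Proof. by []. Qed.
Lemma seriesM_trunc n f g i : (i < n)%N ->
  (f * g) i = (trunc n f * trunc n g)`_i.
Proof. exact: mul1_trunc. Qed.
Lemma seriesB f g n : (f - g) n = f n - g n. Proof. by []. Qed.

Lemma series_sum (I : Type) (r : seq I) (P : pred I) (f : I -> series R) n :
  (\sum_(i <- r | P i) f i) n = \sum_(i <- r | P i) f i n.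
Proof. by elim/big_rec2: _ => // i x y _ <-. Qed.

Lemma seriesMn f m n : (f *+ m) n = f n *+ m.
Proof. by elim: m => // m IH; rewrite !mulrSr -IH. Qed.

Lemma pow1E f n : pow1 f n = (f : series R) ^+ n.
Proof. by elim: n => // n IH; rewrite /pow1 iterS -/(pow1 f n) IH exprS. Qed.

Lemma series_pchar p : p \in [pchar R] -> p \in [pchar (series R)].
Proof.
move=> pcharR; rewrite inE (pcharf_prime pcharR) /=; apply/eqP/funext => n.
by rewrite seriesMn series1 mulrn_pchar.
Qed.

Definition seriesC (c : R) : series R := const1 c.
Definition seriesX : series R := @var1 R.

Lemma seriesCE c n : seriesC c n = if n == 0%N then c else 0.
Proof. by []. Qed.

Lemma seriesCM c f n : (seriesC c * f) n = c * f n.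
Proof.
rewrite seriesM big_ord_recl big1 ?addr0 ?subn0 // => i _.
by rewrite seriesCE mul0r.
Qed.

Fact seriesC_zmod : zmod_morphism seriesC.
Proof.
move=> c d; apply/funext => n; rewrite seriesB !seriesCE.
by case: ifP; rewrite ?subrr.
Qed.
Fact seriesC_monoid : monoid_morphism seriesC.
Proof.
split; first by apply/funext.
move=> c d; apply/funext => n; rewrite seriesCM !seriesCE.
by case: ifP; rewrite ?mulr0.
Qed.
HB.instance Definition _ := GRing.isZmodMorphism.Build R (series R) seriesC seriesC_zmod.
HB.instance Definition _ := GRing.isMonoidMorphism.Build R (series R) seriesC seriesC_monoid.

Lemma seriesXM f n : (seriesX * f) n = if n is m.+1 then f m else 0.
Proof.
rewrite seriesM; case: n => [|n].
  by rewrite big_ord_recl big_ord0 /seriesX /var1 mul0r addr0.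
rewrite !big_ord_recl big1; last first.
  by move=> i _; rewrite /seriesX /var1 /= mul0r.
by rewrite /seriesX /var1 /= mul0r mul1r add0r addr0 /bump /= subSS subn0.
Qed.

Lemma seriesXnM m f n :
  (seriesX ^+ m * f) n = if (m <= n)%N then f (n - m)%N else 0.
Proof.
elim: m n => [|m IH] n; first by rewrite expr0 mul1r subn0.
by rewrite exprS -mulrA seriesXM; case: n => // n; rewrite IH subSS.
Qed.

Lemma seriesXn m n : (seriesX ^+ m) n = (n == m)%:R.
Proof.
rewrite -[_ ^+ m]mulr1 seriesXnM series1.
case: (ltngtP m n) => [lt|lt|->]; last by rewrite subnn.
  by rewrite subn_eq0 leqNgt lt.
by [].
Qed.

End SeriesRing.
Arguments seriesX {R}.

HB.lock Definition sderiv (R : comNzRingType) (f : series R) : series R :=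
  fun n => f n.+1 *+ n.+1.

Section SeriesDerivative.
Variable R : comNzRingType.
Implicit Types f g : series R.

Lemma sderivE f n : sderiv f n = f n.+1 *+ n.+1.
Proof. by rewrite sderiv.unlock. Qed.

Lemma sderivD f g : sderiv (f + g) = sderiv f + sderiv g.
Proof. by apply/funext => n; rewrite seriesD !sderivE seriesD mulrnDl. Qed.

Lemma deriv_trunc n f : (trunc n.+1 f)^`() = trunc n (sderiv f).
Proof.
apply/polyP => i; rewrite coef_deriv !coef_trunc ltnS sderivE.
by case: ifP => //; rewrite mul0rn.
Qed.

Lemma sderivM f g : sderiv (f * g) = sderiv f * g + f * sderiv g.
Proof.
apply/funext => n; rewrite sderivE (seriesM_trunc _ _ (ltnSn n.+1)).
rewrite -coef_deriv derivM coefD !deriv_trunc seriesD.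
rewrite !(seriesM_trunc _ _ (ltnSn n)); congr (_ + _);
  by apply: eq_coefM (ltnSn n) => i lt_in //; rewrite !coef_trunc lt_in (leqW lt_in).
Qed.

End SeriesDerivative.

(** * Substitution into power series *)

(* A complete separated filtration: [fsum s] is the value of the series
   [\sum_n s n] when [s n] has order at least [n] for every [n]. *)
Record filtration (A : comNzRingType) := Filtration {
  fil : nat -> A -> Prop;
  fsum : (nat -> A) -> A;
  fil_0 : forall x, fil 0 x;
  fil0 : forall n, fil n 0;
  filD : forall n x y, fil n x -> fil n y -> fil n (x + y);
  filN : forall n x, fil n x -> fil n (- x);
  filW : forall m n x, (m <= n)%N -> fil n x -> fil m x;
  filM : forall m n x y, fil m x -> fil n y -> fil (m + n) (x * y);
  fil_sep : forall x, (forall n, fil n x) -> x = 0;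
  fsumP : forall s, (forall n, fil n (s n)) ->
    forall n, fil n (fsum s - \sum_(i < n) s i)
}.
Arguments fil0 {A f n}.
Arguments fil_0 {A f}.

Section DiscreteFiltration.
Variable A : comNzRingType.

(** Only 0 has positive order, so a family whose n-th term has order n is concentrated at n = 0 and
    its sum is that term. *)
Let fild (n : nat) (x : A) := (0 < n)%N -> x = 0.

Fact discrete_filM m n x y : fild m x -> fild n y -> fild (m + n) (x * y).
Proof.
rewrite /fild addn_gt0 => fx fy /orP[/fx->|/fy->]; first by rewrite mul0r.
by rewrite mulr0.
Qed.

Fact discrete_fsumP s : (forall n, fild n (s n)) ->
  forall n, fild n (s 0%N - \sum_(i < n) s i).
Proof.
move=> fs [|n] // _; rewrite big_ord_recl big1 ?addr0 ?subrr // => i _.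
exact: fs.
Qed.

Definition discrete : filtration A.
Proof.
refine (@Filtration A fild (fun s => s 0%N) _ _ _ _ _ discrete_filM _
  discrete_fsumP) => //.
- by move=> n x y fx fy /[dup] /fx -> /fy ->; rewrite addr0.
- by move=> n x fx /fx ->; rewrite oppr0.
- by move=> m n x le_mn fx m_gt0; apply: fx; apply: leq_trans le_mn.
- by move=> x /(_ 1%N); apply.
Defined.

End DiscreteFiltration.

Section SeriesFiltration.
Variables (A : comNzRingType) (F : filtration A).

(** The total order: the variable has order 1 and coefficients keep their own order. Applied once to
    a discrete ring this is the X-adic filtration, applied twice the (X,Y)-adic one. *)
Let fils (n : nat) (f : series A) := forall i, fil F (n - i) (f i).

(** At the coefficient i the terms [s m] with m < i are unconstrained and are added directly; from i
    on, [s (i + j) i] has order at least j in A and the sum in A takes over. *)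
Let sums (s : nat -> series A) : series A := fun i =>
  \sum_(m < i) s m i + fsum F (fun j => s (i + j)%N i).

Lemma fil_sum (I : Type) (r : seq I) (P : pred I) (f : I -> A) n :
  (forall i, P i -> fil F n (f i)) -> fil F n (\sum_(i <- r | P i) f i).
Proof. move=> Hf; elim/big_rec: _ => [|i x Pi Hx]; [exact: fil0|]. 
by apply: filD => //; apply: Hf.
Qed.

Fact series_filM m n x y : fils m x -> fils n y -> fils (m + n) (x * y).
Proof.
move=> fx fy i; rewrite seriesM; apply: fil_sum => j _.
apply: filW (filM (fx j) (fy (i - j)%N)).
have := ltn_ord j; rewrite ltnS => le_ji.
rewrite leq_subLR -{1}(subnKC le_ji).
by rewrite addnACA leq_add // -leq_subLR.
Qed.

Fact series_fsumP s : (forall n, fils n (s n)) ->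
  forall n, fils n (sums s - \sum_(i < n) s i).
Proof.
move=> fs n i; rewrite seriesB series_sum /sums.
case: (leqP n i) => [|lt_in].
  by rewrite -subn_eq0 => /eqP ->; apply: fil_0.
have [m ->] : exists m, n = (i + m)%N by exists (n - i)%N; rewrite subnKC // ltnW.
rewrite addKn big_split_ord /= opprD addrACA subrr add0r.
have fs' j : fil F j (s (i + j)%N i) by have := fs (i + j)%N i; rewrite addKn.
exact: fsumP fs' _.
Qed.

Definition series_fil : filtration (series A).
Proof.
refine (@Filtration (series A) fils sums _ _ _ _ _ series_filM _ series_fsumP).
- by move=> f i; rewrite sub0n; apply: fil_0.
- by move=> n i; apply: fil0.
- by move=> n f g ff fg i; apply: filD.
- by move=> n f ff i; apply: filN.
- by move=> m n f le_mn ff i; apply: filW (ff i); apply: leq_sub2r.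
- move=> f ff; apply/funext => i; apply: (@fil_sep _ F) => n.
  by have := ff (n + i)%N i; rewrite addnK.
Defined.

Lemma series_filE n f : fil series_fil n f = forall i, fil F (n - i) (f i).
Proof. by []. Qed.

End SeriesFiltration.

Lemma derX (R : comNzRingType) (d : R -> R) : (forall y z, d (y * z) = d y * z + y * d z) ->
  forall x n, d (x ^+ n) = x ^+ n.-1 *+ n * d x.
Proof.
move=> dM x; have d1 : d 1 = 0.
  by apply: (addIr (d 1)); rewrite add0r -{3}[1]mul1r dM mulr1 mul1r.
case=> [|n] /=; first by rewrite expr0 mulr0n mul0r.
elim: n => [|n IH]; first by rewrite expr1 expr0 mulr1n mul1r.
by rewrite exprS dM IH mulrA mulrnAr -exprS [d x * _]mulrC -mulrDl -mulrS.
Qed.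

(* The value [\sum_n s_n x^n], meaningful when [fil F 1 x]. *)
HB.lock Definition ev (A : comNzRingType) (F : filtration A) (s : series A) (x : A) : A :=
  fsum F (fun n => s n * x ^+ n).

Section Evaluation.
Variables (A : comNzRingType) (F : filtration A).
Local Notation fil := (fil F).
Local Notation ev := (ev F).
Implicit Types (s t : series A) (x y z : A).

Lemma filB n x y : fil n x -> fil n y -> fil n (x - y).
Proof. by move=> fx fy; apply: filD => //; apply: filN. Qed.

Lemma fil_eq x y : (forall n, fil n (x - y)) -> x = y.
Proof. by move=> fxy; apply/eqP; rewrite -subr_eq0; apply/eqP/(fil_sep fxy). Qed.

Lemma filMl n x y : fil n y -> fil n (x * y).
Proof. by move=> fy; rewrite -[n]add0n; apply: filM => //; apply: fil_0. Qed.

Lemma filMr n x y : fil n x -> fil n (x * y).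
Proof. by rewrite mulrC; apply: filMl. Qed.

Lemma filX n x : fil 1 x -> fil n (x ^+ n).
Proof.
move=> fx; elim: n => [|n IH]; first exact: fil_0.
by rewrite exprS -add1n; apply: filM.
Qed.

Variable x : A.
Hypothesis fx : fil 1 x.

Lemma horner_trunc n s : (trunc n s).[x] = \sum_(i < n) s i * x ^+ i.
Proof. exact: horner_poly. Qed.

Lemma evP n s : fil n (ev s x - (trunc n s).[x]).
Proof. by rewrite horner_trunc ev.unlock; apply: fsumP => m; apply/filMl/filX. Qed.

Lemma ev_uniq s z : (forall n, fil n (z - (trunc n s).[x])) -> z = ev s x.
Proof.
move=> fz; apply: fil_eq => n.
have -> : z - ev s x = (z - (trunc n s).[x]) - (ev s x - (trunc n s).[x]) by ring.
by apply: filB => //; apply: evP.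
Qed.

Lemma fil_horner n (q : {poly A}) :
  (forall i, (i < n)%N -> q`_i = 0) -> fil n q.[x].
Proof.
move=> q0; rewrite horner_coef; apply: fil_sum => i _.
case: (ltnP i n) => [/q0->|le_ni]; first by rewrite mul0r; apply: fil0.
exact/filMl/(filW le_ni)/filX.
Qed.

Lemma evD s t : ev (s + t) x = ev s x + ev t x.
Proof.
apply/esym/ev_uniq => n.
have -> : trunc n (s + t) = trunc n s + trunc n t.
  by apply/polyP => i; rewrite coefD !coef_trunc seriesD; case: ifP; rewrite ?addr0.
rewrite hornerD.
have -> (a b c d : A) : a + b - (c + d) = (a - c) + (b - d) by ring.
by apply: filD; apply: evP.
Qed.

Lemma evM s t : ev (s * t) x = ev s x * ev t x.
Proof.
apply/esym/ev_uniq => n.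
pose q := trunc n s * trunc n t - trunc n (s * t).
have -> : ev s x * ev t x - (trunc n (s * t)).[x] =
  (ev s x - (trunc n s).[x]) * ev t x +
  (trunc n s).[x] * (ev t x - (trunc n t).[x]) + q.[x].
  by rewrite /q hornerD hornerN hornerM; ring.
apply: filD; first by apply: filD; [apply/filMr/evP|apply/filMl/evP].
apply: fil_horner => i lt_in.
by rewrite coefB coef_trunc lt_in (seriesM_trunc _ _ lt_in) subrr.
Qed.

Lemma ev_poly s (q : {poly A}) : (forall i, s i = q`_i) -> ev s x = q.[x].
Proof.
move=> sq; apply/esym/ev_uniq => n; rewrite -hornerN -hornerD.
by apply: fil_horner => i lt_in; rewrite coefB coef_trunc lt_in sq subrr.
Qed.

Lemma evC c : ev (seriesC c) x = c.
Proof. by rewrite (@ev_poly _ c%:P) ?hornerC // => i; rewrite coefC. Qed.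

Lemma ev0 : ev 0 x = 0.
Proof. by rewrite (@ev_poly _ 0) ?horner0 // => i; rewrite coef0. Qed.

Lemma evB s t : ev (s - t) x = ev s x - ev t x.
Proof. by apply: (addIr (ev t x)); rewrite -evD !subrK. Qed.

Lemma ev1 : ev 1 x = 1.
Proof. by rewrite -(evC 1) rmorph1. Qed.

Lemma evX : ev seriesX x = x.
Proof. by rewrite (@ev_poly _ 'X) ?hornerX // => i; rewrite coefX. Qed.

Lemma evXn s n : ev (s ^+ n) x = ev s x ^+ n.
Proof. by elim: n => [|n IH]; rewrite ?ev1 // !exprS evM IH. Qed.

Lemma fil_ev n s : (forall i, fil (n - i) (s i)) -> fil n (ev s x).
Proof.
move=> fs; rewrite -[ev s x](subrK (trunc n s).[x]).
apply: filD; first exact: evP.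
rewrite horner_trunc; apply: fil_sum => i _.
have := filM (fs i) (filX i fx); rewrite subnK //; exact/ltnW/ltn_ord.
Qed.

(** The chain rule holds on truncations, and the hypothesis that d lowers orders by at most one is
    the continuity that carries it to the limit. It serves both for d/dX on one-variable series and
    for d/dY on two-variable ones. *)
Lemma ev_deriv (d : A -> A) s :
    {morph d : y z / y + z} -> (forall y z, d (y * z) = d y * z + y * d z) ->
    (forall n y, fil n.+1 y -> fil n (d y)) -> (forall i, d (s i) = 0) ->
  d (ev s x) = ev (sderiv s) x * d x.
Proof.
move=> dD dM dfil ds.
have d0 : d 0 = 0 by apply: (addIr (d 0)); rewrite -dD !add0r.
have dN y : d (- y) = - d y by apply: (addIr (d y)); rewrite -dD !addNr d0.
have d1 : d 1 = 0 by have := derX dM x 0; rewrite expr0 mulr0n mul0r.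
have dX n : d (x ^+ n.+1) = x ^+ n *+ n.+1 * d x := derX dM x n.+1.
have dsum n : d (trunc n.+1 s).[x] = (trunc n (sderiv s)).[x] * d x.
  rewrite !horner_trunc big_ord_recl dD dM ds expr0 d1 mul0r mulr0 !add0r.
  rewrite (big_morph d dD d0) mulr_suml; apply: eq_bigr => i _.
  by rewrite dM ds mul0r add0r dX sderivE !mulrnAl mulrnAr mulrA.
apply: fil_eq => n.
have -> : d (ev s x) - ev (sderiv s) x * d x =
  d (ev s x - (trunc n.+1 s).[x])
   - (ev (sderiv s) x - (trunc n (sderiv s)).[x]) * d x.
  by rewrite dD dN dsum; ring.
by apply: filB; [apply/dfil/evP|apply/filMr/evP].
Qed.

End Evaluation.

Section SeriesMap.
Variables (R S : comNzRingType) (phi : {rmorphism R -> S}).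

Definition smap (f : series R) : series S := fun n => phi (f n).

Fact smap_zmod : zmod_morphism smap.
Proof. by move=> f g; apply/funext => n; rewrite /smap !seriesB rmorphB. Qed.
Fact smap_monoid : monoid_morphism smap.
Proof.
split; first by apply/funext => n; rewrite /smap !series1 rmorph_nat.
move=> f g; apply/funext => n; rewrite /smap !seriesM rmorph_sum.
by apply: eq_bigr => i _; rewrite rmorphM.
Qed.
HB.instance Definition _ := GRing.isZmodMorphism.Build _ _ smap smap_zmod.
HB.instance Definition _ := GRing.isMonoidMorphism.Build _ _ smap smap_monoid.

Lemma smapE f n : smap f n = phi (f n). Proof. by []. Qed.

Lemma smapC c : smap (seriesC c) = seriesC (phi c).
Proof. by apply/funext => n; rewrite /smap !seriesCE; case: ifP; rewrite ?rmorph0. Qed.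

Lemma smapX : smap seriesX = seriesX.
Proof. by apply/funext => n; rewrite /smap /seriesX /var1 rmorph_nat. Qed.

Lemma smap_sderiv f : smap (sderiv f) = sderiv (smap f).
Proof. by apply/funext => n; rewrite smapE !sderivE smapE rmorphMn. Qed.

End SeriesMap.

Section SeriesCoef0.
Variable R : comNzRingType.

Definition cstcoef (f : series R) : R := f 0%N.

Fact cstcoef_zmod : zmod_morphism cstcoef. Proof. by []. Qed.
Fact cstcoef_monoid : monoid_morphism cstcoef.
Proof.
split=> // f g; rewrite /cstcoef seriesM big_ord_recl big_ord0 addr0.
by rewrite subn0.
Qed.
HB.instance Definition _ := GRing.isZmodMorphism.Build _ _ cstcoef cstcoef_zmod.
HB.instance Definition _ := GRing.isMonoidMorphism.Build _ _ cstcoef cstcoef_monoid.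

Lemma cstcoefX (f : series R) n : (f ^+ n) 0%N = f 0%N ^+ n.
Proof. exact: (rmorphXn cstcoef). Qed.

Lemma cstcoefM (f g : series R) : (f * g) 0%N = f 0%N * g 0%N.
Proof. exact: (rmorphM cstcoef). Qed.

Lemma fil_cstcoef (F : filtration R) (f : series R) :
  f 0%N = 0 -> fil (series_fil F) 1 f.
Proof.
move=> f0; rewrite series_filE => -[|i]; first by rewrite f0; apply: fil0.
by rewrite subSS sub0n; apply: fil_0.
Qed.

Lemma fil_seriesC (F : filtration R) n c : fil F n c -> fil (series_fil F) n (seriesC c).
Proof.
move=> fc; rewrite series_filE => -[|i]; rewrite seriesCE ?subn0 //.
exact: fil0.
Qed.

Lemma filMn (F : filtration R) n x m : fil F n x -> fil F n (x *+ m).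
Proof. by move=> fx; rewrite -mulr_natl; apply: filMl. Qed.

Lemma fil_sderiv (F : filtration R) n (f : series R) :
  fil (series_fil F) n.+1 f -> fil (series_fil F) n (sderiv f).
Proof.
rewrite !series_filE => ff i; rewrite sderivE; apply: filMn.
by have := ff i.+1; rewrite subSS.
Qed.

(** The inverse is the geometric series evaluated at 1 - f. *)
Lemma series_invertible (f : series R) : f 0%N = 1 -> exists g, f * g = 1.
Proof.
move=> f0; pose x := 1 - f; pose D := series_fil (discrete R).
have fx : fil D 1 x by apply: fil_cstcoef; rewrite /x seriesB series1 f0 subrr.
pose geo : series (series R) := fun=> 1.
exists (ev D geo x).
have -> : f = ev D (1 - seriesX) x.
  rewrite evD // ev1 // -[- _]mulN1r evM // evX //.
  have -> : ev D (-1) x = -1 by rewrite -(evC fx (-1)) rmorphN rmorph1.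
  by rewrite /x; ring.
rewrite -evM // -(ev1 fx); congr (ev D _ x); apply/funext => n.
rewrite mulrBl mul1r seriesB seriesXM series1.
by case: n => [|n]; rewrite /geo ?subr0 ?subrr.
Qed.

Lemma coefX_trunc n (f : series R) m i : (i < n)%N ->
  (f ^+ m) i = (trunc n f ^+ m)`_i.
Proof.
move=> lt_in; elim: m i lt_in => [|m IH] i lt_in.
  by rewrite !expr0 series1 coef1.
rewrite !exprS (seriesM_trunc _ _ lt_in).
by apply: eq_coefM lt_in => // j lt_jn; rewrite coef_trunc lt_jn IH.
Qed.

Lemma series_Frobenius p (f : series R) n : p \in [pchar R] ->
  (f ^+ p) n = if (p %| n)%N then f (n %/ p)%N ^+ p else 0.
Proof.
move=> pcharR; have p_gt0 := prime_gt0 (pcharf_prime pcharR).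
have pcharP : p \in [pchar {poly R}] by rewrite pchar_poly.
rewrite (coefX_trunc _ _ (ltnSn n)) /trunc poly_def.
rewrite -(pFrobenius_autE pcharP) rmorph_sum /= coef_sum.
under eq_bigr => i _.
  rewrite pFrobenius_autE exprZn -exprM coefZ coefXn.
  over.
case: dvdnP => [[m ->]|ndiv].
  rewrite mulnK //; have lt_mn : (m < (m * p).+1)%N by rewrite ltnS leq_pmulr.
  rewrite (bigD1 (Ordinal lt_mn)) //= eqxx mulr1 big1 ?addr0 // => i /eqP ne_im.
  rewrite eqn_pmul2r //; case: eqP => [eq_im|_]; last by rewrite mulr0.
  by case: ne_im; apply: val_inj.
rewrite big1 // => i _; case: eqP => [eq_n|_]; last by rewrite mulr0.
by case: ndiv; exists i.
Qed.

End SeriesCoef0.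

(** The lowest nonzero coefficients of f and g multiply to a nonzero coefficient of the product. *)
Lemma seriesM_eq0 (R : idomainType) (f g : series R) : f * g = 0 -> f = 0 \/ g = 0.
Proof.
have least (h : series R) : h <> 0 -> exists n, h n != 0 /\ forall i, (i < n)%N -> h i = 0.
  move=> h_neq0; have ex_h : exists n, h n != 0.
    apply: contrapT => noh; apply: h_neq0; apply/funext => n.
    by apply/eqP; apply: contrapT => hn; apply: noh; exists n; apply/negP.
  case: (ex_minnP ex_h) => n hn min_n; exists n; split=> // i lt_in.
  by apply/eqP; apply: contraTT lt_in => /min_n; rewrite -leqNgt.
move=> fg0; have [->|/least[m [fm f_lt]]] := pselect (f = 0); first by left.
have [->|/least[n [gn g_lt]]] := pselect (g = 0); first by right.
have /eqP := congr1 (@^~ (m + n)%N) fg0; rewrite series0 seriesM.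
have lt_m : (m < (m + n).+1)%N by rewrite ltnS leq_addr.
rewrite (bigD1 (Ordinal lt_m)) //= addKn big1.
  by rewrite addr0 mulf_eq0 (negPf fm) (negPf gn).
move=> i /eqP ne_im; case: (ltngtP i m) => [/f_lt ->|lt_mi|eq_im].
- by rewrite mul0r.
- rewrite (g_lt (m + n - i)%N) ?mulr0 //.
  by rewrite ltn_subLR ?ltn_add2r // -ltnS.
- by case: ne_im; apply: val_inj.
Qed.

(** * Series in two variables *)

Lemma sderivC (R : comNzRingType) (c : R) : sderiv (seriesC c) = 0.
Proof. by apply/funext => n; rewrite !sderivE seriesCE /= mul0rn. Qed.

Lemma sderiv0 (R : comNzRingType) : sderiv (0 : series R) = 0.
Proof. by apply/funext => n; rewrite sderivE mul0rn. Qed.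

Lemma sderiv1 (R : comNzRingType) : sderiv (1 : series R) = 0.
Proof. exact: (sderivC 1). Qed.

(** The derivative in the inner variable X; on two-variable series [sderiv] is the derivative in the
    outer variable Y. *)
HB.lock Definition dX (k : fieldType) (G : series (series k)) : series (series k) :=
  fun j => sderiv (G j).

Section TwoVariables.
Variable k : fieldType.
Local Notation P1 := (series k).
Local Notation P2 := (series (series k)).
Local Notation F1 := (series_fil (discrete k)).
Local Notation F2 := (series_fil F1).

(* The coefficient of X^i Y^j is the i-th coefficient of the j-th one, so that
   [seriesX : P2] is Y and [seriesC f : P2] is f(X). *)
Definition flip2 (G : ps2 k) : P2 := fun j i => G i j.

Lemma flip2_mul G H : flip2 (mul2 G H) = flip2 G * flip2 H.
Proof.
apply/funext => b; apply/funext => a; rewrite seriesM series_sum.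
rewrite /flip2 /mul2 exchange_big /=; apply: eq_bigr => j _.
by rewrite seriesM.
Qed.

Lemma pow2E G n a b : pow2 G n a b = (flip2 G ^+ n) b a.
Proof.
rewrite -[LHS]/(flip2 (pow2 G n) b a); congr (_ b a).
elim: n => [|n IH]; last by rewrite exprS -IH -flip2_mul.
apply/funext => j; apply/funext => i; rewrite expr0 series1 /flip2 /= /one2 andbC.
by case: (j == 0%N); rewrite // mulr1n series1.
Qed.

Lemma fil1E (R : comNzRingType) n (f : series R) :
  fil (series_fil (discrete R)) n f <-> forall i, (i < n)%N -> f i = 0.
Proof.
rewrite series_filE; split=> f0 i; first by rewrite -subn_gt0 => /f0.
by rewrite /= subn_gt0 => /f0.
Qed.

Lemma fil2E n (G : P2) :
  fil F2 n G <-> forall i j, (i + j < n)%N -> G j i = 0.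
Proof.
rewrite series_filE; split=> [fG i j lt_n|G0 j].
  by have /fil1E := fG j; apply; rewrite ltn_subRL addnC.
by apply/fil1E => i; rewrite ltn_subRL addnC => /G0.
Qed.

Definition constXY : {rmorphism k -> P2} := (@seriesC P1 \o @seriesC k)%FUN.

(** f(Y), as opposed to f(X), which is [seriesC f]. *)
Definition atY : {rmorphism P1 -> P2} := smap (@seriesC k).

Lemma atYE f j : atY f j = seriesC (f j). Proof. by []. Qed.

(** Restriction to X = 0, a series in Y. *)
Definition atX0 : {rmorphism P2 -> P1} := smap (@cstcoef k).

Lemma atX0E G j : atX0 G j = G j 0%N. Proof. by []. Qed.

Lemma dXE (G : P2) j : dX G j = sderiv (G j).
Proof. by rewrite dX.unlock. Qed.

Lemma dXD (G H : P2) : dX (G + H) = dX G + dX H.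
Proof. by apply/funext => j; rewrite seriesD !dXE seriesD sderivD. Qed.

Lemma sderiv_sum (I : Type) (r : seq I) (P : pred I) (f : I -> P1) :
  sderiv (\sum_(i <- r | P i) f i) = \sum_(i <- r | P i) sderiv (f i).
Proof.
by elim/big_rec2: _ => [|i x y _ <-]; [exact: sderiv0|exact: sderivD].
Qed.

Lemma dXM (G H : P2) : dX (G * H) = dX G * H + G * dX H.
Proof.
apply/funext => j; rewrite dXE seriesD !seriesM sderiv_sum -big_split /=.
by apply: eq_bigr => i _; rewrite sderivM !dXE.
Qed.

Lemma fil_dX n G : fil F2 n.+1 G -> fil F2 n (dX G).
Proof.
rewrite !series_filE => fG j; rewrite dXE; case: (leqP j n) => [le_jn|lt_nj].
  by apply: fil_sderiv; rewrite -subSn.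
by move/ltnW: lt_nj; rewrite -subn_eq0 => /eqP ->; apply: fil_0.
Qed.

Definition subst (g f : P1) : P1 := ev F1 (smap (@seriesC _) f) g.

Section Substitution.
Variable g : P1.
Hypothesis g0 : g 0%N = 0.

Let fg : fil F1 1 g. Proof. exact: fil_cstcoef. Qed.
Let fX : fil F1 1 (seriesX : P1). Proof. exact: fil_cstcoef. Qed.

Lemma substB f h : subst g (f - h) = subst g f - subst g h.
Proof. by rewrite /subst rmorphB evB. Qed.
Lemma substD f h : subst g (f + h) = subst g f + subst g h.
Proof. by rewrite /subst rmorphD evD. Qed.
Lemma substM f h : subst g (f * h) = subst g f * subst g h.
Proof. by rewrite /subst rmorphM evM. Qed.
Lemma subst0 : subst g 0 = 0.
Proof. by rewrite /subst rmorph0 ev0. Qed.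
Lemma substC c : subst g (seriesC c) = seriesC c.
Proof. by rewrite /subst smapC evC. Qed.
Lemma substX : subst g seriesX = g.
Proof. by rewrite /subst smapX evX. Qed.

Lemma fil_subst n f : fil F1 n f -> fil F1 n (subst g f).
Proof. by move=> ff; apply: fil_ev => // i; apply/fil_seriesC/ff. Qed.

(** G(g(X), X): the inner variable goes to g and the outer one to X. With G = F this is the step
    from [n]_F to [n+1]_F. *)
Definition subXY (G : P2) : P1 := ev F1 (fun j => subst g (G j)) seriesX.

Lemma subXYD G H : subXY (G + H) = subXY G + subXY H.
Proof.
rewrite /subXY -evD //; congr (ev _ _ _); apply/funext => j.
by rewrite !seriesD substD.
Qed.
Lemma subXYB G H : subXY (G - H) = subXY G - subXY H.
Proof.
rewrite /subXY -evB //; congr (ev _ _ _); apply/funext => j.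
by rewrite !seriesB substB.
Qed.
Lemma subXYM G H : subXY (G * H) = subXY G * subXY H.
Proof.
rewrite /subXY -evM //; congr (ev _ _ _); apply/funext => j.
rewrite !seriesM (big_morph (subst g) substD subst0).
by apply: eq_bigr => i _; rewrite substM.
Qed.
Lemma subXYC f : subXY (seriesC f) = subst g f.
Proof.
rewrite /subXY -[RHS](evC fX); congr (ev _ _ _); apply/funext => j.
by rewrite !seriesCE; case: ifP; rewrite ?subst0.
Qed.
Lemma subXY_atY f : subXY (atY f) = f.
Proof.
apply/esym/ev_uniq => // n; apply/fil1E => i lt_in.
rewrite horner_trunc seriesB series_sum (bigD1 (Ordinal lt_in)) //= substC.
rewrite seriesCM seriesXn eqxx mulr1 big1 ?addr0 ?subrr // => j /eqP ne_ji.
rewrite substC seriesCM seriesXn; case: eqP => [eq_ij|_]; last by rewrite mulr0.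
by case: ne_ji; apply: val_inj.
Qed.
Lemma subXY0 : subXY 0 = 0.
Proof. by rewrite -(rmorph0 atY) subXY_atY. Qed.
Lemma subXY1 : subXY 1 = 1.
Proof. by rewrite -(rmorph1 atY) subXY_atY. Qed.
Lemma subXYX G n : subXY (G ^+ n) = subXY G ^+ n.
Proof. by elim: n => [|n IH]; rewrite ?subXY1 // !exprS subXYM IH. Qed.

Lemma fil_subXY n G : fil F2 n G -> fil F1 n (subXY G).
Proof. by move=> fG; apply: fil_ev => // j; apply/fil_subst/fG. Qed.

End Substitution.

Lemma subXY_comp2 (G : ps2 k) (g : P1) : g 0%N = 0 ->
  comp2 G g (@var1 k) = subXY g (flip2 G).
Proof.
move=> g0; apply/funext => n; rewrite /comp2 exchange_big /=.
have fg : fil F1 1 g by apply: fil_cstcoef.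
have fX : fil F1 1 (seriesX : P1) by apply: fil_cstcoef.
have /fil1E/(_ n (ltnSn n))/eqP := evP fX n.+1 (fun j => subst g (flip2 G j)).
rewrite seriesB subr_eq0 /subXY => /eqP ->; rewrite horner_trunc series_sum.
apply: eq_bigr => j _.
have -> : (subst g (flip2 G j) * seriesX ^+ j) n =
  ((trunc n.+1 (smap (@seriesC _) (flip2 G j))).[g] * seriesX ^+ j) n.
  apply/eqP; rewrite -subr_eq0 -seriesB -mulrBl; apply/eqP.
  by have /fil1E := filMr (seriesX ^+ j) (evP fg n.+1 (smap (@seriesC _) (flip2 G j))); apply.
rewrite horner_trunc mulr_suml series_sum; apply: eq_bigr => i _.
by rewrite smapE -mulrA seriesCM !pow1E.
Qed.

End TwoVariables.

(** * Composition f(G(X,Y)) with a unital two-variable series *)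

Section Composition.
Variable k : fieldType.
Local Notation P1 := (series k).
Local Notation P2 := (series (series k)).
Local Notation F1 := (series_fil (discrete k)).
Local Notation F2 := (series_fil F1).

Definition unital (G : ps2 k) :=
  (forall i, G i 0%N = var1 k i) /\ (forall j, G 0%N j = var1 k j).

(** [omega] is G_X(0,Y) and [rho] is G_Y(X,0). For a formal group law their reciprocals are the
    densities of the differentials invariant under translation on the two sides. *)
Definition omega (G : ps2 k) : P1 := fun j => G 1%N j.
Definition rho (G : ps2 k) : P1 := fun i => G i 1%N.

Definition compose (G : ps2 k) (f : P1) : P2 :=
  ev F2 (smap (constXY k) f) (flip2 G).

Variable G : ps2 k.
Hypothesis unitG : unital G.
Local Notation K := (flip2 G).

Lemma flip2_coef0 : K 0%N = seriesX.
Proof. by apply/funext => i; rewrite /flip2 (proj1 unitG). Qed.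

Lemma flip2_atX0 : atX0 k K = seriesX.
Proof. by apply/funext => j; rewrite atX0E /flip2 (proj2 unitG). Qed.

Lemma fil_flip2 : fil F2 1 K.
Proof.
apply/fil2E => i j; rewrite ltnS leqn0 addn_eq0 => /andP[/eqP-> /eqP->].
by rewrite /flip2 (proj1 unitG).
Qed.
Let fK := fil_flip2.

Lemma composeM f g : compose G (f * g) = compose G f * compose G g.
Proof. by rewrite /compose rmorphM evM. Qed.
Lemma compose1 : compose G 1 = 1.
Proof. by rewrite /compose rmorph1 ev1. Qed.
Lemma composeXn f n : compose G (f ^+ n) = compose G f ^+ n.
Proof. by rewrite /compose rmorphXn evXn. Qed.
Lemma composeE f a b n : (a + b < n)%N ->
  compose G f b a = \sum_(m < n) f m * pow2 G m a b.
Proof.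
move=> lt_n; have /fil2E/(_ a b lt_n)/eqP := evP fK n (smap (constXY k) f).
rewrite !seriesB subr_eq0 => /eqP; rewrite /compose => ->.
rewrite horner_trunc !series_sum; apply: eq_bigr => m _.
by rewrite smapE /= !seriesCM pow2E.
Qed.

Lemma compose_dY f : sderiv (compose G f) = compose G (sderiv f) * sderiv K.
Proof.
rewrite /compose (ev_deriv fK (d := @sderiv P1)).
- by rewrite smap_sderiv.
- exact: sderivD.
- exact: sderivM.
- by move=> n y; apply: fil_sderiv.
- by move=> i; rewrite smapE sderivC.
Qed.

Lemma pow2_X0 n b : pow2 G n 0 b = (b == n)%:R.
Proof.
rewrite pow2E -[LHS]/(atX0 k (K ^+ n) b) rmorphXn.
by rewrite [atX0 k K]flip2_atX0 seriesXn.
Qed.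

Lemma pow2_Y0 n a : pow2 G n a 0 = (a == n)%:R.
Proof. by rewrite pow2E cstcoefX flip2_coef0 seriesXn. Qed.

(** Differentiating G^n in X at X = 0, where G(0,Y) = Y, gives n Y^(n-1) G_X(0,Y). *)
Lemma pow2_X1 n b : pow2 G n 1 b = (seriesX ^+ n.-1 * omega G) b *+ n.
Proof.
have -> : pow2 G n 1 b = atX0 k (dX (K ^+ n)) b.
  by rewrite pow2E atX0E dXE sderivE mulr1n.
rewrite (derX (@dXM k)) rmorphM rmorphMn rmorphXn [atX0 k K]flip2_atX0.
have -> : atX0 k (dX K) = omega G.
  by apply/funext => j; rewrite atX0E dXE sderivE mulr1n.
by rewrite mulrnAl seriesMn.
Qed.

Lemma pow2_Y1 n a : pow2 G n a 1 = (seriesX ^+ n.-1 * rho G) a *+ n.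
Proof.
have -> : pow2 G n a 1 = sderiv (K ^+ n) 0%N a.
  by rewrite pow2E !sderivE mulr1n.
rewrite (derX (@sderivM P1)) cstcoefM seriesMn cstcoefX flip2_coef0.
have -> : sderiv K 0%N = rho G.
  by apply/funext => i; rewrite !sderivE mulr1n.
by rewrite mulrnAl seriesMn.
Qed.

Lemma subXY_comp g f : g 0%N = 0 -> subXY g (compose G f) = subst (subXY g K) f.
Proof.
move=> g0; have sK0 : subXY g K 0%N = 0.
  have /fil1E := fil_subXY g0 fK; exact.
apply: ev_uniq; first exact: fil_cstcoef.
move=> n; have := fil_subXY g0 (evP fK n (smap (constXY k) f)).
rewrite subXYB // !horner_trunc (big_morph _ (subXYD g0) (subXY0 g0)).
rewrite (eq_bigr (fun i : 'I_n => smap (@seriesC k) f i * subXY g K ^+ i)) //.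
by move=> i _; rewrite subXYM // subXYX // smapE subXYC // substC.
Qed.


End Composition.

(** * The adjoint character is trivial *)

(** The product is expanded along the coefficients of f so as to match [pow2_X1] and [pow2_Y1]: the
    linear part of f(G) in one variable then becomes f' times [omega] or [rho]. The index n = b + 1
    is the last one that contributes. *)
Lemma sderiv_mulE (R : comNzRingType) (f g : series R) b :
  (sderiv f * g) b = \sum_(n < b.+2) f n * ((seriesX ^+ n.-1 * g) b *+ n).
Proof.
rewrite seriesM [RHS]big_ord_recl /= mulr0n mulr0 add0r; apply: eq_bigr => i _.
by rewrite /bump /= seriesXnM -ltnS ltn_ord !sderivE mulrnAl mulrnAr.
Qed.

Section MultiplicativeCharacter.
Variables (k : fieldType) (p : nat).
Hypothesis pchark : p \in [pchar k].
Local Notation P1 := (series k).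
Local Notation P2 := (series (series k)).

Let p_gt1 : (1 < p)%N. Proof. exact/prime_gt1/(pcharf_prime pchark). Qed.
Let p_gt0 : (0 < p)%N. Proof. exact: ltnW. Qed.

Lemma sum_dvdn (f : nat -> k) n : (forall i, ~~ (p %| i)%N -> f i = 0) ->
  \sum_(i < n * p) f i = \sum_(i < n) f (i * p)%N.
Proof.
move=> f0; elim: n => [|n IH]; first by rewrite !big_ord0.
rewrite big_ord_recr /= -IH mulSnr big_split_ord /=; congr (_ + _).
rewrite (bigD1 (Ordinal p_gt0)) //= addn0 big1 ?addr0 // => i /eqP ne_i0.
apply: f0; rewrite dvdn_addr ?dvdn_mull // gtnNdvd // lt0n.
by apply/eqP => i0; apply: ne_i0; apply: val_inj.
Qed.

Definition twist (G : ps2 k) : ps2 k := fun i j => G i j ^+ p.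

Lemma twist_unital G : unital G -> unital (twist G).
Proof.
by case=> Gr Gl; split=> i; rewrite /twist ?Gr ?Gl /var1;
  case: (_ == _); rewrite ?expr1n ?expr0n ?eqn0Ngt ?p_gt0.
Qed.

Lemma pow2_twist G n a b : pow2 (twist G) n a b = pow2 G n a b ^+ p.
Proof.
rewrite !pow2E.
have -> : flip2 (twist G) = smap (smap (pFrobenius_aut pchark)) (flip2 G).
  by [].
by rewrite -rmorphXn.
Qed.

(** G^(np) is the p-th power of G^n, hence a series in X^p and Y^p whose coefficients are p-th
    powers. *)
Lemma pow2_Frobenius (G : ps2 k) n a b :
  pow2 G (n * p) (a * p) (b * p) = pow2 G n a b ^+ p.
Proof.
have pchar1 : p \in [pchar P1] by apply: series_pchar.
rewrite !pow2E exprM (series_Frobenius _ _ pchar1) dvdn_mull // mulnK //.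
by rewrite (series_Frobenius _ _ pchark) dvdn_mull // mulnK.
Qed.

Lemma twist_inj (G : ps2 k) : omega (twist G) = rho (twist G) -> omega G = rho G.
Proof.
move=> eqt; apply/funext => j; apply: (fmorph_inj (pFrobenius_aut pchark)).
exact: (congr1 (@^~ j) eqt).
Qed.

Lemma sderiv_eq0 (u : P1) n : sderiv u = 0 -> ~~ (p %| n)%N -> u n = 0.
Proof.
case: n => [|n] u0 ndiv; first by rewrite dvdn0 in ndiv.
have /eqP := congr1 (@^~ n) u0; rewrite !sderivE series0 -mulr_natr mulf_eq0.
by rewrite -(dvdn_pcharf pchark) (negPf ndiv) orbF => /eqP.
Qed.

(* A character u of G is either trivial or forces omega = rho: comparing the
   derivatives of u(G(X,Y)) = u(X) u(Y) at X = 0 and at Y = 0 gives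
   u' omega = u' rho, and if u' = 0 then u = u_1(X^p) where u_1 is a character
   of the Frobenius twist of G. *)
Lemma character_trivial n (G : ps2 k) (u : P1) : unital G -> u 0%N = 1 ->
    (forall a b, compose G u b a = u a * u b) ->
  omega G = rho G \/ forall i, (0 < i < n)%N -> u i = 0.
Proof.
elim: n G u => [|n IH] G u unitG u0 uG; first by right=> i; rewrite ltn0 andbF.
have uo b : (sderiv u * omega G) b = u 1%N * u b.
  rewrite sderiv_mulE -uG (@composeE _ _ unitG u 1 b b.+2) //.
  by apply: eq_bigr => i _; rewrite pow2_X1.
have ur b : (sderiv u * rho G) b = u 1%N * u b.
  rewrite sderiv_mulE mulrC -uG (@composeE _ _ unitG u b 1 b.+2) ?addn1 //.
  by apply: eq_bigr => i _; rewrite pow2_Y1.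
have : sderiv u * (omega G - rho G) = 0.
  by apply/funext => b; rewrite mulrBr seriesB uo ur subrr.
case/seriesM_eq0 => [du0|/eqP]; last by rewrite subr_eq0 => /eqP; left.
pose u1 : P1 := fun i => u (i * p)%N.
have := IH (twist G) u1 (twist_unital unitG) u0.
case=> [a b|/twist_inj|u1_0]; [|by left|right].
  rewrite /u1 -uG (@composeE _ _ unitG u _ _ ((a + b).+1 * p)); last first.
    by rewrite -mulnDl ltn_mul2r p_gt0 /=.
  rewrite (@sum_dvdn (fun m => u m * pow2 G m (a * p) (b * p))); last first.
    by move=> i /(sderiv_eq0 du0) ->; rewrite mul0r.
  rewrite (composeE (twist_unital unitG) _ (ltnSn _)); apply: eq_bigr => i _.
  by rewrite pow2_twist pow2_Frobenius.
move=> i /andP[i_gt0 lt_in]; case: (boolP (p %| i)%N) => [|/(sderiv_eq0 du0)//].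
case/dvdnP => m def_i; rewrite def_i -[LHS]/(u1 m); apply: u1_0.
move: i_gt0 lt_in; rewrite def_i muln_gt0 p_gt0 andbT => m_gt0 lt_mp.
(* Since p is at least 2, m p < n + 1 with m > 0 forces m < n, which is the range of the induction
   hypothesis. *)
by rewrite m_gt0 -ltnS (leq_trans _ lt_mp) // !ltnS -[X in (X < _)%N]muln1 ltn_mul2l m_gt0.
Qed.

End MultiplicativeCharacter.

(** Here dx, dy are F_X, F_Y; wx, rx, vx are omega, rho, 1/omega at X, and wy, ry, vy the same at Y;
    c, d are omega(F) and 1/omega(F). As dy ry is rho(F), the conclusion says that rho/omega is
    multiplicative along F. *)
Lemma character_identity (A : comNzRingType) (dx dy c d wx rx vx wy ry vy : A) :
    dx * wx = c -> dx * rx = dy * wy ->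
    wx * vx = 1 -> wy * vy = 1 -> c * d = 1 ->
  dy * ry * d = (rx * vx) * (ry * vy).
Proof.
move=> dx_wx dx_rx vX vY cd.
have -> : dy = dx * rx * vy by rewrite dx_rx -mulrA vY mulr1.
have -> : dx = c * vx by rewrite -dx_wx -mulrA vX mulr1.
by rewrite -[RHS]mulr1 -cd; ring.
Qed.

(** * Associativity to first order and the equality of the two invariant differentials *)

Section InvariantDerivations.
Variables (k : fieldType) (F : ps2 k).
Hypothesis fglF : formal_group_law F.
Local Notation P1 := (series k).
Local Notation P2 := (series (series k)).
Local Notation K := (flip2 F).

Lemma fgl_unital : unital F.
Proof. by case: fglF. Qed.
Let unitF := fgl_unital.

Lemma dX_mulE f a b : (dX K * seriesC f) b a =
  \sum_(n < a.+2) F n b * ((seriesX ^+ n.-1 * f) a *+ n).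
Proof. by rewrite mulrC seriesCM mulrC dXE; apply: (sderiv_mulE (K b)). Qed.

Lemma dY_mulE f a b : (sderiv K * atY k f) b a =
  \sum_(n < b.+2) F a n * ((seriesX ^+ n.-1 * f) b *+ n).
Proof.
rewrite -(sderiv_mulE (F a : P1)) !seriesM series_sum; apply: eq_bigr => i _.
by rewrite atYE mulrC seriesCM mulrC !sderivE seriesMn.
Qed.

(** The part of associativity that is linear in the first variable; [dY_rho] is the part linear in
    the last variable and [dX_rho] the part linear in the middle one. *)
Lemma dX_omega : dX K * seriesC (omega F) = compose F (omega F).
Proof.
apply/funext => c; apply/funext => b; rewrite dX_mulE.
rewrite (composeE unitF _ (ltnSn _)) -[RHS]/(assoc_right F 1 b c) -fgl_assoc //.
by apply: eq_bigr => n _; rewrite pow2_X1.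
Qed.

Lemma dY_rho : sderiv K * atY k (rho F) = compose F (rho F).
Proof.
apply/funext => b; apply/funext => a; rewrite dY_mulE.
rewrite (composeE unitF _ (ltnSn _)) -[RHS]/(assoc_left F a b 1) fgl_assoc //.
rewrite /assoc_right addn1.
by apply: eq_bigr => n _; rewrite pow2_Y1.
Qed.

Lemma dX_rho : dX K * seriesC (rho F) = sderiv K * atY k (omega F).
Proof.
apply/funext => c; apply/funext => a; rewrite dX_mulE dY_mulE.
transitivity (assoc_left F a 1 c).
  by rewrite /assoc_left addn1; apply: eq_bigr => n _; rewrite pow2_Y1.
by rewrite fgl_assoc //; apply: eq_bigr => n _; rewrite pow2_X1.
Qed.

Lemma omega0 : omega F 0%N = 1.
Proof. by rewrite /omega (proj1 unitF). Qed.
Lemma rho0 : rho F 0%N = 1.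
Proof. by rewrite /rho (proj2 unitF). Qed.

(* The adjoint character rho / omega is trivial. *)
Lemma omega_rho p : p \in [pchar k] -> omega F = rho F.
Proof.
move=> pchark; have [v vP] := series_invertible omega0.
pose u := rho F * v.
have u0 : u 0%N = 1.
  rewrite /u cstcoefM rho0 mul1r.
  by have := congr1 (@^~ 0%N) vP; rewrite /= cstcoefM omega0 mul1r.
have uF : compose F u = seriesC u * atY k u.
  have vX : seriesC (omega F) * seriesC v = 1 :> P2 by rewrite -rmorphM vP rmorph1.
  have vY : atY k (omega F) * atY k v = 1 by rewrite -rmorphM vP rmorph1.
  have vF : compose F (omega F) * compose F v = 1 by rewrite -composeM // vP compose1.
  rewrite /u composeM // !rmorphM -dY_rho.
  exact: character_identity dX_omega dX_rho vX vY vF.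
apply: contrapT => neq.
have u1 : u = 1.
  apply/funext => i; rewrite series1.
  have uab a b : compose F u b a = u a * u b.
    by rewrite uF seriesCM atYE mulrC seriesCM mulrC.
  have [//|uz] := character_trivial pchark i.+1 unitF u0 uab.
  by case: i uz => // i; apply; rewrite /= ltnS leqnn.
by apply: neq; rewrite -[RHS]mulr1 -vP mulrCA -/u u1 mulr1.
Qed.

End InvariantDerivations.

(** * Iterates and the Hasse invariant *)

Section ChainRule.
Variable k : fieldType.
Local Notation P1 := (series k).
Local Notation P2 := (series (series k)).
Local Notation F1 := (series_fil (discrete k)).
Local Notation F2 := (series_fil F1).
Variable g : P1.
Hypothesis g0 : g 0%N = 0.

Lemma subst_deriv (f : P1) : sderiv (subst g f) = subst g (sderiv f) * sderiv g.
Proof.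
rewrite /subst (ev_deriv (fil_cstcoef (discrete k) g0) (d := @sderiv k)).
- by rewrite smap_sderiv.
- exact: sderivD.
- exact: sderivM.
- by move=> n y; apply: fil_sderiv.
- by move=> i; rewrite smapE sderivC.
Qed.

Lemma subst_shift (f : P1) :
  subst g f = seriesC (f 0%N) + g * subst g (fun n => f n.+1).
Proof.
have {1}-> : f = seriesC (f 0%N) + seriesX * ((fun n => f n.+1) : P1).
  apply/funext => n; rewrite seriesD seriesXM seriesCE.
  by case: n => [|n]; rewrite ?addr0 ?add0r.
by rewrite substD // substM // substC // substX.
Qed.

Lemma subst_cstcoef (f : P1) : subst g f 0%N = f 0%N.
Proof. by rewrite subst_shift seriesD cstcoefM g0 mul0r addr0 seriesCE. Qed.

Lemma subXY_seriesX : subXY g seriesX = seriesX.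
Proof. by rewrite -(smapX (@seriesC k)) -[LHS]/(subXY g (atY k seriesX)) subXY_atY. Qed.

(** The defect [err] of the chain rule is a derivation along the substitution. It vanishes on series
    in X and on Y, hence on polynomials in Y, and it lowers orders by at most one, so it vanishes
    everywhere by density. *)
Lemma subXY_deriv (G : P2) : sderiv (subXY g G) =
  subXY g (dX G) * sderiv g + subXY g (sderiv G).
Proof.
pose err (H : P2) :=
  sderiv (subXY g H) - (subXY g (dX H) * sderiv g + subXY g (sderiv H)).
have errD H H' : err (H + H') = err H + err H'.
  have add_err (a a' b b' c c' d : P1) : a + a' - ((b + b') * d + (c + c')) =
    a - (b * d + c) + (a' - (b' * d + c')) by ring.
  by rewrite /err dXD !subXYD // !sderivD !subXYD //; apply: add_err.
have errM H H' : err (H * H') = err H * subXY g H' + subXY g H * err H'.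
  have mul_err (a a' b b' c c' d x x' : P1) :
    a * x' + x * a' - ((b * x' + x * b') * d + (c * x' + x * c')) =
    (a - (b * d + c)) * x' + x * (a' - (b' * d + c')) by ring.
  by rewrite /err dXM [subXY g (H * H')]subXYM // !sderivM !subXYD // !subXYM //; apply: mul_err.
have err0 : err 0 = 0 by apply: (addIr (err 0)); rewrite -errD !add0r.
have errC f : err (seriesC f) = 0.
  rewrite /err subXYC // subst_deriv // sderivC subXY0 // addr0.
  have -> : dX (seriesC f) = seriesC (sderiv f).
    apply/funext => j; rewrite dXE !seriesCE.
    by case: ifP; rewrite ?sderiv0.
  by rewrite subXYC // subrr.
have sX (R : comNzRingType) : sderiv (seriesX : series R) = 1.
  apply/funext => n; rewrite !sderivE /seriesX /var1 series1 eqSS.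
  by case: eqP => [->|]; rewrite ?mul0rn ?mulr1n.
have errX : err seriesX = 0.
  rewrite /err subXY_seriesX !sX subXY1 //.
  have -> : dX (seriesX : P2) = 0.
    apply/funext => j; rewrite dXE /seriesX /var1 series0.
    by case: (j == 1%N); rewrite ?mulr1n ?mulr0n ?sderiv0 ?sderiv1.
  by rewrite subXY0 // mul0r add0r subrr.
have errXn n : err (seriesX ^+ n) = 0.
  elim: n => [|n IH]; last by rewrite exprS errM IH errX mul0r mulr0 addr0.
  by rewrite expr0 -(rmorph1 (@seriesC P1)) errC.
have fil_err n H : fil F2 n.+1 H -> fil F1 n (err H).
  move=> fH; apply: filB; first exact/fil_sderiv/(fil_subXY g0 fH).
  apply: filD; first exact/filMr/(fil_subXY g0)/fil_dX.
  by apply/(fil_subXY g0)/fil_sderiv.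
apply: (@fil_eq _ F1) => n; rewrite -/(err G).
pose S := \sum_(j < n.+1) seriesC (G j) * seriesX ^+ j : P2.
have errS : err S = 0.
  rewrite /S (big_morph err errD err0) big1 // => j _.
  by rewrite errM errC errXn mul0r mulr0 addr0.
rewrite -(subrK S G) errD errS addr0; apply: fil_err.
rewrite series_filE => j; case: (ltnP j n.+1) => [lt_jn|le_nj]; last first.
  by move: le_nj; rewrite -subn_eq0 => /eqP ->; apply: fil_0.
rewrite seriesB /S series_sum (bigD1 (Ordinal lt_jn)) //= seriesCM seriesXn eqxx.
rewrite mulr1 big1 ?addr0 ?subrr; first by [].
move=> i /eqP ne_ij; rewrite seriesCM seriesXn; case: eqP => [eq_ij|_].
  by case: ne_ij; apply: val_inj.
by rewrite mulr0.
Qed.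

End ChainRule.

(** * Finite differences of sequences of series *)

Section FiniteDifferences.
Variables (k : fieldType).
Local Notation P1 := (series k).
Local Notation F1 := (series_fil (discrete k)).
Implicit Types a b : nat -> P1.

Definition diff a : nat -> P1 := fun n => a n.+1 - a n.
Arguments diff : simpl never.

Lemma iter_diffD m a b n :
  iter m diff (fun i => a i + b i) n = iter m diff a n + iter m diff b n.
Proof. by elim: m n => [|m IH] n //=; rewrite /diff !IH; ring. Qed.

Lemma iter_diffM m a c n :
  iter m diff (fun i => a i * c) n = iter m diff a n * c.
Proof. by elim: m n => [|m IH] n //=; rewrite /diff !IH; ring. Qed.

Lemma iter_diff_sum m (r : nat) (a : nat -> nat -> P1) n :
  iter m diff (fun i => \sum_(j < r) a j i) n = \sum_(j < r) iter m diff (a j) n.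
Proof.
elim: m n => [|m IH] n //=; rewrite /diff !IH -sumrB.
by apply: eq_bigr.
Qed.

Lemma fil_iter_diff M m a n :
  (forall i, fil F1 M (a i)) -> fil F1 M (iter m diff a n).
Proof. by move=> fa; elim: m n => [//|m IH] n; rewrite iterS; apply: filB. Qed.

Lemma Newton_forward m a n :
  a (n + m)%N = \sum_(j < m.+1) iter j diff a n *+ 'C(m, j).
Proof.
elim: m n a => [|m IH] n a; first by rewrite big_ord1 addn0 bin0 mulr1n.
rewrite addnS -addSn IH.
have shift j : iter j diff a n.+1 = iter j diff a n + diff (iter j diff a) n.
  by rewrite /diff addrC subrK.
under eq_bigr => j _ do rewrite shift mulrnDl.
rewrite big_split /= [RHS]big_ord_recl /= bin0 mulr1n.
under [in RHS]eq_bigr => j _ do rewrite /bump /= add1n add0n binS mulrnDr.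
rewrite [in RHS]big_split /= addrA; congr (_ + _).
rewrite big_ord_recl bin0 mulr1n; congr (_ + _).
by rewrite [RHS]big_ord_recr /= bin_small // mulr0n addr0.
Qed.

(** The shift is 1 + [diff], and in characteristic p its p-th power is 1 + [diff]^p. *)
Lemma iter_diff_pchar p a n : p \in [pchar k] ->
  iter p diff a n = a (n + p)%N - a n.
Proof.
move=> pchark; have p_prime := pcharf_prime pchark.
have pchar1 : p \in [pchar P1] by apply: series_pchar.
rewrite Newton_forward big_ord_recl /= bin0 mulr1n.
case: p p_prime pchar1 {pchark} => // q p_prime pchar1.
rewrite big_ord_recr /= /bump /= add1n binn mulr1n big1 ?add0r.
  by rewrite addrC addKr.
move=> i _; rewrite -mulr_natr.
have /dvdnP[c ->] : (q.+1 %| 'C(q.+1, i.+1))%N.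
  by apply: prime_dvd_bin; rewrite //= ltnS.
by rewrite natrM (pcharf0 pchar1) mulr0 mulr0.
Qed.

End FiniteDifferences.
Arguments diff {k} a n : simpl never.

(** * The multiples [n]_F, the invariant derivation and the Hasse invariant *)

Section Nfold.
Variables (k : fieldType) (F : ps2 k) (p : nat).
Hypothesis fglF : formal_group_law F.
Hypothesis pchark : p \in [pchar k].
Local Notation P1 := (series k).
Local Notation P2 := (series (series k)).
Local Notation F1 := (series_fil (discrete k)).
Local Notation F2 := (series_fil F1).
Local Notation K := (flip2 F).
Local Notation w := (rho F).
Local Notation nfold := (fgl_nfold F : nat -> P1).

Let unitF := fgl_unital fglF.
Let p_gt1 : (1 < p)%N. Proof. exact/prime_gt1/(pcharf_prime pchark). Qed.
Let p_gt0 : (0 < p)%N. Proof. exact: ltnW. Qed.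

Lemma nfold0 : nfold 0%N = 0.
Proof. exact: (rmorph0 (@seriesC k)). Qed.

Lemma nfold_cst n : nfold n 0%N = 0.
Proof.
elim: n => [|n IH]; first by rewrite nfold0.
rewrite /fgl_nfold iterS -/(nfold n) subXY_comp2 //.
by have /fil1E := fil_subXY IH (fil_flip2 unitF); apply.
Qed.

Lemma nfoldS n : nfold n.+1 = subXY (nfold n) K.
Proof. by rewrite -subXY_comp2 ?nfold_cst. Qed.

Lemma subst_nfoldS n f : subst (nfold n.+1) f = subXY (nfold n) (compose F f).
Proof. by rewrite nfoldS subXY_comp // nfold_cst. Qed.

(** The invariant differential dX/w is pulled back by [n]_F to n times itself. Both terms of the
    chain rule for F([n](X), X) are handled by an invariance identity with the same w because
    [omega] and [rho] agree. *)
Lemma nfold_deriv n : sderiv (nfold n) * w = subst (nfold n) w *+ n.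
Proof.
elim: n => [|n IH].
  by rewrite nfold0 mulr0n sderiv0 mul0r.
have n0 := nfold_cst n.
rewrite nfoldS subXY_deriv // mulrDl -mulrA IH mulrnAr -subXYC // -subXYM //.
rewrite -{1}(omega_rho fglF pchark) dX_omega //.
rewrite -[X in _ + _ * X](subXY_atY n0) -subXYM // dY_rho //.
by rewrite (omega_rho fglF pchark) subXY_comp // -mulrSr.
Qed.

Lemma nfold_p_deriv : sderiv (nfold p) = 0.
Proof.
have [v vP] := series_invertible (rho0 fglF).
have pchar1 : p \in [pchar P1] by apply: series_pchar.
by rewrite -[LHS]mulr1 -vP mulrA nfold_deriv mulrn_pchar // mul0r.
Qed.

Lemma nfold_p_dvdn n : ~~ (p %| n)%N -> nfold p n = 0.
Proof. by apply: sderiv_eq0 => //; apply: nfold_p_deriv. Qed.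

(** By [nfold_p_dvdn], [p]_F is always a series in X^p, so height 1 only asks that its coefficient
    at X^p be nonzero. *)
Lemma has_height1 : nfold p p != 0 -> has_height p F (Some 1%N).
Proof.
move=> hp; split; [|split=> //].
  by move=> Np0; have := hp; rewrite Np0 /const1 eqn0Ngt p_gt0 eqxx.
exists (fun n => nfold p (n * p)%N); split; rewrite ?mul0n ?mul1n ?nfold_cst //.
move=> n; rewrite /subst_exp expn1; case: (boolP (p %| n)%N) => [/divnK -> //|].
exact: nfold_p_dvdn.
Qed.

(** The invariant derivation w d/dX, which is the part of f(F(X,Y)) linear in Y. *)
Definition invder (f : P1) : P1 := w * sderiv f.

Lemma compose_Y0 (f : P1) : compose F f 0%N = f.
Proof.
apply/funext => a; rewrite (composeE unitF f (ltnSn _)) addn0.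
rewrite (bigD1 ord_max) //= pow2_Y0 // eqxx mulr1 big1 ?addr0 // => i.
rewrite pow2_Y0 // -val_eqE /= => /negPf ne_ia.
by rewrite eq_sym ne_ia mulr0.
Qed.

Lemma compose_X0 (f : P1) j : compose F f j 0%N = f j.
Proof.
rewrite (composeE unitF f (ltnSn _)) add0n (bigD1 ord_max) //= pow2_X0 // eqxx mulr1.
rewrite big1 ?addr0 // => i; rewrite pow2_X0 // -val_eqE /= => /negPf ne_ij.
by rewrite eq_sym ne_ij mulr0.
Qed.

Lemma compose_Y1 (f : P1) : compose F f 1%N = invder f.
Proof.
have := congr1 (@^~ 0%N) (compose_dY unitF f).
rewrite /= sderivE mulr1n => ->; rewrite cstcoefM compose_Y0 sderivE mulr1n.
by rewrite /invder mulrC; congr (_ * _); apply/funext.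
Qed.

(* The Y-expansion of f([n](Y) +_F Y) gives
   f([n+1]) - f([n]) = (invder f)([n]) Y + O(Y^2). *)
Lemma iter_diff_nfold m (f : P1) n : fil F1 m.+1
  (iter m diff (fun i => subst (nfold i) f) n
   - subst (nfold n) (iter m invder f) * seriesX ^+ m).
Proof.
elim: m f n => [|m IH] f n.
  rewrite -[iter 0 diff _ n]/(subst (nfold n) f) -[iter 0 invder f]/f.
  by rewrite expr0 mulr1 subrr; apply: fil0.
have fX : fil F1 1 (seriesX : P1) by apply: fil_cstcoef.
pose h (j : nat) i := subst (nfold i) (compose F f j.+2) * seriesX ^+ j.+2.
pose r i := diff (fun i => subst (nfold i) f) i
  - subst (nfold i) (invder f) * seriesX - \sum_(j < m) h j i.
have fr i : fil F1 m.+2 (r i).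
  have := evP fX m.+2 (fun j => subst (nfold i) (compose F f j)).
  rewrite -/(subXY _ _) -subst_nfoldS horner_trunc 2!big_ord_recl /=.
  rewrite compose_Y0 compose_Y1 expr0 mulr1 expr1 /r /diff.
  rewrite !opprD !addrA; congr (fil F1 _ (_ - _)).
have -> : iter m.+1 diff (fun i => subst (nfold i) f) n =
  iter m diff (fun i => r i + (subst (nfold i) (invder f) * seriesX
    + \sum_(j < m) h j i)) n.
  rewrite iterSr; congr (iter m diff _ n); apply/funext => i.
  by rewrite /r; move: (diff _ i) (_ * _) (\sum_(j < m) _) => x s t; ring.
clearbody r; rewrite !iter_diffD iter_diffM iter_diff_sum iterSr.
have -> (x y z t : P1) : x + (y + z) - t = x + ((y - t) + z) by ring.
apply: filD; first exact: (fil_iter_diff m n fr).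
(* The terms of degree at least 2 in Y are negligible: by induction the m-th difference of their
   coefficients has order at least m, and the factor X^(j+2) supplies the missing 2. *)
apply: filD; last first.
  apply: fil_sum => j _; rewrite iter_diffM -(addn2 m).
  apply: filM; last first.
    apply: (@filW _ _ _ j.+2) => //; exact: filX.
  rewrite -[iter _ _ _ _](subrK (subst (nfold n)
    (iter m invder (compose F f j.+2)) * seriesX ^+ m)).
  apply: filD; first exact: filW (IH _ _).
  exact/filMl/filX.
rewrite exprSr mulrA -mulrBl -[m.+2]addn1.
exact: filM.
Qed.

(* In characteristic p the p-th difference of a sequence a is a(n + p) - a(n). *)
Lemma Hasse (f : P1) : subst (nfold p) f p = iter p invder f 0%N.
Proof.
have /fil1E/(_ p (ltnSn p))/eqP := iter_diff_nfold (m := p) f 0%N.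
rewrite seriesB subr_eq0 iter_diff_pchar // seriesB add0n => /eqP.
have z : (0 : P1) 0%N = 0 by [].
rewrite nfold0 [subst 0 f]subst_shift // mul0r addr0 seriesCE eqn0Ngt p_gt0 subr0 => ->.
by rewrite mulrC seriesXnM leqnn subnn subst_cstcoef.
Qed.

(** As w(0) = 1, each application turns the leading term c X^m into m c X^(m-1), while the constant
    term dies at once. *)
Lemma iter_invder m (f : P1) : (0 < m)%N ->
  (forall i, (0 < i < m)%N -> f i = 0) -> iter m invder f 0%N = f m *+ m`!.
Proof.
elim: m f => [//|[_ f _ _|m IH f _ f0]].
  rewrite /= /invder cstcoefM rho0 // mul1r sderivE.
  by rewrite factS fact0 muln1.
rewrite iterSr IH //; last first.
  move=> i /andP[i_gt0 lt_im]; rewrite /invder seriesM big1 // => j _.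
  rewrite sderivE f0 ?mul0rn ?mulr0 //= ltnS.
  by rewrite (leq_ltn_trans (leq_subr _ _)).
rewrite /invder seriesM big_ord_recl rho0 // mul1r subn0 big1 ?addr0.
  by rewrite sderivE -mulrnA -factS.
move=> j _; rewrite sderivE f0 ?mul0rn ?mulr0 //= ltnS.
by rewrite /bump add1n subSS ltnS leq_subr.
Qed.

End Nfold.

(** * The truncated logarithm *)

Lemma series2M (R : comNzRingType) (G H : series (series R)) i j :
  (G * H) j i =
  \sum_(b < j.+1) \sum_(a < i.+1) G b a * H (j - b)%N (i - a)%N.
Proof. by rewrite seriesM series_sum. Qed.

Section TruncatedLogarithm.
Variables (k : fieldType) (F : ps2 k) (p : nat).
Hypothesis fglF : formal_group_law F.
Hypothesis pchark : p \in [pchar k].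
Local Notation P1 := (series k).
Local Notation P2 := (series (series k)).
Local Notation F1 := (series_fil (discrete k)).
Local Notation K := (flip2 F).
Local Notation w := (rho F).

Let unitF := fgl_unital fglF.
Let p_prime := pcharf_prime pchark.
Let p_gt1 : (1 < p)%N. Proof. exact: prime_gt1. Qed.
Let p_gt0 : (0 < p)%N. Proof. exact: ltnW. Qed.

Lemma natr_neq0 n : (0 < n < p)%N -> n%:R != 0 :> k.
Proof. by move=> /andP[n_gt0 lt_np]; rewrite -(dvdn_pcharf pchark) gtnNdvd. Qed.

Lemma fact_neq0 m : (m < p)%N -> m`!%:R != 0 :> k.
Proof.
elim: m => [|m IH] lt_mp; first by rewrite fact0 oner_neq0.
by rewrite factS natrM mulf_neq0 ?IH 1?ltnW // natr_neq0.
Qed.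

(** Integrating 1/w termwise settles every coefficient of [invder F l] below X^(p-1). The
    coefficient of X^(p-1) is out of reach of integration, and [Hasse] ties it to the coefficient of
    X^p in [p]_F. *)
Lemma exists_log : fgl_nfold F p p = 0 -> exists l : P1,
  [/\ l 0%N = 0, l 1%N = 1 &
      forall i, (i < p)%N -> invder F l i = (i == 0%N)%:R].
Proof.
move=> hp; have [v vP] := series_invertible (rho0 fglF).
(* The series stops below degree p, where the integration would divide by p. *)
pose l : P1 := fun n => if (0 < n < p)%N then v n.-1 / n%:R else 0.
have v0 : v 0%N = 1.
  by have := congr1 (@^~ 0%N) vP; rewrite /= cstcoefM rho0 // mul1r.
have dl i : (i.+1 < p)%N -> sderiv l i = v i.
  move=> lt_ip; rewrite sderivE /l lt_ip /= -[LHS]mulr_natr divfK //.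
  exact: natr_neq0.
have low i : (i.+1 < p)%N -> invder F l i = (i == 0%N)%:R.
  move=> lt_ip; rewrite -series1 -vP /invder !seriesM; apply: eq_bigr => j _.
  by rewrite dl // (leq_ltn_trans _ lt_ip) // ltnS leq_subr.
exists l; split=> [//||i lt_ip].
  by rewrite /l p_gt1 /= v0 divr1.
case: (ltnP i.+1 p) => [/low //|le_pi].
have def_i : p = i.+1 by apply/eqP; rewrite eqn_leq le_pi.
have i_gt0 : (0 < i)%N by rewrite -ltnS -def_i.
have N0 := nfold_cst fglF p.
have Np : fil F1 p.+1 (fgl_nfold F p : P1).
  apply/fil1E => j; rewrite ltnS leq_eqVlt => /orP[/eqP -> //|lt_jp].
  have [-> //|j_gt0] := posnP j.
  by rewrite (nfold_p_dvdn fglF pchark) // gtnNdvd.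
(* The left side is 0 because [p]_F has order at least p + 1. On the right, [invder F l] has the
   form 1 + c X^(p-1) + ..., so its remaining p - 1 invariant derivatives give (p-1)! c at the
   origin. *)
have := Hasse fglF pchark l.
rewrite subst_shift // seriesD seriesCE eqn0Ngt p_gt0 add0r.
have /fil1E -> // := filMr (subst (fgl_nfold F p) (fun n => l n.+1)) Np.
rewrite [in X in iter X]def_i iterSr iter_invder //; last first.
  move=> j /andP[j_gt0 lt_ji]; rewrite low; last by rewrite def_i ltnS.
  by rewrite eqn0Ngt j_gt0.
move/esym/eqP; rewrite -[X in X == 0]mulr_natr mulf_eq0 (negPf (fact_neq0 lt_ip)) orbF.
by move/eqP ->; rewrite eqn0Ngt i_gt0.
Qed.

(** F^p is a series in X^p and Y^p without constant term, so every F^n with n >= p lies in the ideal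
    (X^p, Y^p). *)
Lemma pow2_large n i j : (p <= n)%N -> (i < p)%N -> (j < p)%N ->
  pow2 F n i j = 0.
Proof.
move=> le_pn lt_ip lt_jp; rewrite pow2E -(subnKC le_pn) exprD seriesM series_sum.
have pchar1 : p \in [pchar P1] by apply: series_pchar.
rewrite big1 // => l _; rewrite (series_Frobenius _ _ pchar1).
case: (boolP (p %| l)%N) => [|_]; last by rewrite mul0r.
have lt_lp : (l < p)%N by apply: leq_ltn_trans lt_jp; rewrite -ltnS.
case: (posnP l) => [->|l_gt0]; last by rewrite gtnNdvd.
by rewrite div0n flip2_coef0 // seriesXnM leqNgt lt_ip.
Qed.

Variable l : P1.
Hypothesis l0 : l 0%N = 0.
Hypothesis dl : forall i, (i < p)%N -> invder F l i = (i == 0%N)%:R.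

(** Congruence modulo the ideal (X^p, Y^p). *)
Definition agree (G H : P2) := forall i j, (i < p)%N -> (j < p)%N -> G j i = H j i.

Lemma agreeX G H n : agree G H -> agree (G ^+ n) (H ^+ n).
Proof.
move=> GH; elim: n => [|n IH] i j lt_ip lt_jp; first by rewrite !expr0.
rewrite !exprS !series2M; apply: eq_bigr => b _; apply: eq_bigr => a _.
rewrite GH ?IH //.
- by apply: leq_ltn_trans lt_ip; apply: leq_subr.
- by apply: leq_ltn_trans lt_jp; apply: leq_subr.
- by apply: leq_ltn_trans lt_ip; rewrite -ltnS.
- by apply: leq_ltn_trans lt_jp; rewrite -ltnS.
Qed.

(** By invariance w(Y) times the Y-derivative of l(F) is (w l')(F), which is 1 modulo (X^p, Y^p).
    For fixed i > 0 one divides by w(Y) and integrates in Y, which is legitimate for 0 < j < p; so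
    all mixed coefficients vanish, and the others are those of l(X) and l(Y). *)
Lemma log_additive : agree (compose F l) (seriesC l + atY k l).
Proof.
have dY : sderiv (compose F l) * atY k w = compose F (invder F l).
  rewrite compose_dY // -mulrA dY_rho // -composeM // mulrC; congr (compose F _).
have [v vP] := series_invertible (rho0 fglF).
have dY0 i j : (0 < i < p)%N -> (j < p)%N ->
    (sderiv (compose F l) * atY k w) j i = 0.
  move=> /andP[i_gt0 lt_ip] lt_jp; rewrite dY (composeE unitF _ (ltnSn _)).
  rewrite big1 // => n _; case: (ltnP n p) => [lt_np|le_pn].
    rewrite dl //; case: (posnP n) => [->|n_gt0].
      by rewrite /= /one2 (eqn0Ngt i) i_gt0 mulr0.
    by rewrite mul0r.
  by rewrite pow2_large ?mulr0.
move=> i j lt_ip lt_jp; rewrite seriesD.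
rewrite seriesD seriesCE atYE seriesCE.
case: (posnP j) => [->|j_gt0].
  by rewrite compose_Y0 // l0; case: ifP; rewrite addr0.
rewrite series0 add0r.
case: (posnP i) => [->|i_gt0]; first exact: compose_X0.
pose f : P1 := fun j => compose F l j i.
have fw b : (sderiv f * w) b = (sderiv (compose F l) * atY k w) b i.
  rewrite !seriesM series_sum; apply: eq_bigr => c _.
  by rewrite atYE [X in _ = X i]mulrC seriesCM !sderivE seriesMn mulrC.
have : sderiv f j.-1 = 0.
  rewrite -[sderiv f]mulr1 -vP mulrA seriesM big1 // => c _.
  rewrite fw dY0 ?mul0r ?i_gt0 //; apply: leq_ltn_trans lt_jp.
  by rewrite -ltnS; apply: leq_trans (ltn_ord c) _; rewrite prednK.
rewrite sderivE prednK // -mulr_natr => /eqP; rewrite mulf_eq0.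
by rewrite (negPf (natr_neq0 _)) ?j_gt0 // orbF => /eqP.
Qed.

(** The binomial expansion of (l(X) + l(Y))^m against l(F)^m; the powers F^n with n >= p drop out by
    [pow2_large], so that the sum has the range used by [expd]. *)
Lemma log_pow_additive m i j : (i < p)%N -> (j < p)%N ->
  \sum_(n < p) (l ^+ m) n * pow2 F n i j =
  \sum_(a < m.+1) (l ^+ (m - a)) i * (l ^+ a) j *+ 'C(m, a).
Proof.
move=> lt_ip lt_jp; transitivity (compose F (l ^+ m) j i).
  rewrite (@composeE _ _ unitF _ i j (p + p)); last first.
    by rewrite -addSn leq_add // ltnW.
  rewrite big_split_ord /= [X in _ = _ + X]big1 ?addr0 // => n _.
  by rewrite pow2_large ?mulr0 // leq_addr.
rewrite composeXn // (agreeX m log_additive) // exprDn !series_sum.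
apply: eq_bigr => a _; rewrite -!rmorphXn !seriesMn; congr (_ *+ _).
by rewrite seriesCM [atY k _ _]atYE mulrC seriesCM mulrC.
Qed.

End TruncatedLogarithm.

(** * Exponentials of derivations *)

Section PairSums.
Variables (V : nmodType) (q : nat).

Lemma sum_pairs (a : 'I_q) (f : nat -> nat -> V) :
  \sum_(i : 'I_q * 'I_q | (i.1 + i.2 == a)%N) f i.1 i.2 =
  \sum_(i < a.+1) f i (a - i)%N.
Proof.
rewrite -(pair_big_dep xpredT (fun i j : 'I_q => (i + j == a)%N)
  (fun i j => f i j)) /=.
rewrite (big_ord_widen q (fun i => f i (a - i)%N)) ?ltn_ord //.
rewrite [RHS]big_mkcond; apply: eq_bigr => i _.
case: ltnP => [|lt_ai]; first rewrite ltnS => le_ia.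
  have lt_q : (a - i < q)%N by apply: leq_ltn_trans (ltn_ord a); apply: leq_subr.
  rewrite (big_pred1 (Ordinal lt_q)) // => j /=.
  by rewrite -val_eqE /= -[RHS](eqn_add2l i) subnKC.
rewrite big1 // => j /eqP def_a.
by have := leq_addr j i; rewrite def_a leqNgt lt_ai.
Qed.

Lemma sum_triangle (f : nat -> nat -> V) :
    (forall a b, (q <= a + b)%N -> f a b = 0) ->
  \sum_(a < q) \sum_(b < q) f a b = \sum_(m < q) \sum_(b < m.+1) f (m - b)%N b.
Proof.
move=> f0; rewrite exchange_big pair_big /=.
transitivity (\sum_(i : 'I_q * 'I_q) \sum_(m < q | (i.1 + i.2 == m)%N) f i.2 i.1).
  apply: eq_bigr => i _; case: (ltnP (i.1 + i.2) q) => [lt_q|le_q].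
    by rewrite (big_pred1 (Ordinal lt_q)) // => m; rewrite -val_eqE /= eq_sym.
  rewrite f0; last by rewrite addnC.
  by rewrite big1.
rewrite (exchange_big_dep xpredT) //=; apply: eq_bigr => m _.
exact: (sum_pairs m (fun i j => f j i)).
Qed.

End PairSums.

(** Coefficients of a product in degrees below q involve only coefficients in degrees below q, so
    truncation commutes with powers. *)
Lemma tpow2E (k : fieldType) (F : ps2 k) q n (i j : 'I_q) :
  tpow2 (@trunc2 k q F) n i j = pow2 F n i j.
Proof.
elim: n i j => [|n IH] i j; first by [].
rewrite /tpow2 iterS -/(tpow2 _ n) /tmul2 /pow2 iterS -/(pow2 F n) /mul2.
rewrite -(sum_pairs i (fun a a' => \sum_(b < j.+1) F a b * pow2 F n a' (j - b)%N)).
apply: eq_bigr => a _.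
rewrite -(sum_pairs j (fun b b' => F a.1 b * pow2 F n a.2 b')).
by apply: eq_bigr => b _; rewrite IH.
Qed.

Section ExpDerivation.
Variables (k : fieldType) (F : ps2 k) (p : nat).
Hypothesis fglF : formal_group_law F.
Hypothesis pchark : p \in [pchar k].
Variable l : series k.
Hypothesis l0 : l 0%N = 0.
Hypothesis dl : forall i, (i < p)%N -> invder F l i = (i == 0%N)%:R.

Variables (R : comNzRingType) (iota : {rmorphism k -> R}) (d : R -> R).
Hypothesis dD : {morph d : r s / r + s}.
Hypothesis dM : forall r s, d (r * s) = d r * s + r * d s.
Hypothesis dC : forall c, d (iota c) = 0.
Hypothesis dp : forall r, iter p d r = 0.

Local Notation FR := (series_fil (discrete R)).

Let p_gt1 : (1 < p)%N. Proof. exact/prime_gt1/(pcharf_prime pchark). Qed.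
Let p_gt0 : (0 < p)%N. Proof. exact: ltnW. Qed.

(* d^n / n!, meaningful only for n < p. *)
Definition divpow (r : R) : series R := fun n => iota (n`!%:R)^-1 * iter n d r.

(* exp(l(X) d) *)
Definition expd (n : nat) (r : R) : R :=
  \sum_(m < p) divpow r m * iota ((l ^+ m) n).

Lemma iter_derD n : {morph iter n d : r s / r + s}.
Proof. by elim: n => // n IH r s; rewrite !iterS IH dD. Qed.

Lemma iter_derMc n r c : iter n d (r * iota c) = iter n d r * iota c.
Proof. by elim: n => //= n ->; rewrite dM dC mulr0 addr0. Qed.

Lemma divpowD r s : divpow (r + s) = divpow r + divpow s.
Proof. by apply/funext => n; rewrite seriesD /divpow iter_derD mulrDr. Qed.

Lemma divpowMc r c n : divpow (r * iota c) n = divpow r n * iota c.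
Proof. by rewrite /divpow iter_derMc mulrA. Qed.

Lemma sderiv_divpow r n : (n.+1 < p)%N -> sderiv (divpow r) n = divpow (d r) n.
Proof.
move=> lt_np; rewrite sderivE /divpow -iterSr -mulrnAl -rmorphMn.
congr (iota _ * _); rewrite factS natrM invfM -[LHS]mulr_natr mulrAC mulVf ?mul1r //.
exact: (natr_neq0 pchark).
Qed.

Lemma natr_inj n r s : (0 < n < p)%N -> r *+ n = s *+ n -> r = s :> R.
Proof.
move=> np eq_rs; have n_neq0 := natr_neq0 pchark np.
have cancel_n t : t *+ n * iota n%:R^-1 = t.
  by rewrite -mulr_natr -(rmorph_nat iota) -mulrA -rmorphM divff // rmorph1 mulr1.
by rewrite -[r]cancel_n eq_rs cancel_n.
Qed.

(** The Leibniz formula for d^n/n!: by [sderiv_divpow] both sides satisfy the same differential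
    recursion, and n + 1 can be cancelled as long as it is below p. *)
Lemma divpowM r s n : (n < p)%N -> divpow (r * s) n = (divpow r * divpow s) n.
Proof.
elim: n r s => [|n IH] r s lt_np.
  by rewrite cstcoefM /divpow /= fact0 invr1 rmorph1 !mul1r.
apply: (@natr_inj n.+1); first by rewrite lt_np.
rewrite -!sderivE sderiv_divpow // dM divpowD sderivM !seriesD.
rewrite !IH ?(ltnW lt_np) // !seriesM.
congr (_ + _); apply: eq_bigr => i _; congr (_ * _); apply/esym/sderiv_divpow.
  by apply: leq_ltn_trans lt_np.
by apply: leq_ltn_trans lt_np; rewrite ltnS leq_subr.
Qed.

Lemma divpow2E r a b :
  divpow (divpow r b) a = iota (a`!%:R^-1 * b`!%:R^-1) * iter (a + b) d r.
Proof.
rewrite /divpow [iota b`!%:R^-1 * _]mulrC iter_derMc iterD rmorphM -mulrA.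
by rewrite [iter a d _ * _]mulrC.
Qed.

(** The vanishing of d^p enters here: otherwise composing two exponentials would produce powers of d
    from p on, which have no counterpart in [expd]. *)
Lemma divpow2_large r a b : (p <= a + b)%N -> divpow (divpow r b) a = 0.
Proof. by move=> le_p; rewrite divpow2E -(subnKC le_p) iterD dp mulr0. Qed.

Lemma divpow2 r m b : (m < p)%N -> (b <= m)%N ->
  divpow (divpow r b) (m - b)%N = divpow r m *+ 'C(m, b).
Proof.
move=> lt_mp le_bm; rewrite divpow2E subnK // /divpow -mulrnAl -rmorphMn.
congr (iota _ * _); have nz n : (n < p)%N -> n`!%:R != 0 :> k.
  exact: (fact_neq0 pchark).
rewrite -(bin_fact le_bm) !natrM !invfM.
have lt_b := leq_ltn_trans le_bm lt_mp.
have lt_mb := leq_ltn_trans (leq_subr b m) lt_mp.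
have C_neq0 : 'C(m, b)%:R != 0 :> k.
  by have := nz m lt_mp; rewrite -(bin_fact le_bm) natrM mulf_eq0 => /norP[].
by rewrite -[RHS]mulr_natr mulrAC mulVf // mul1r mulrC.
Qed.

Let iotal : series R := smap iota l.

Let fl : fil FR 1 iotal.
Proof. by apply: fil_cstcoef; rewrite /iotal smapE l0 rmorph0. Qed.

(** Since l has no constant term, the powers l^m with m >= p do not reach degrees below p. Hence the
    finite sum defining [expd] is a value of [ev] in these degrees and inherits its
    multiplicativity. *)
Lemma expdE (f : series R) n : (n < p)%N ->
  ev FR (smap (@seriesC R) f) iotal n = \sum_(m < p) f m * iota ((l ^+ m) n).
Proof.
move=> lt_np; have /fil1E/(_ n lt_np)/eqP := evP fl p (smap (@seriesC R) f).
rewrite seriesB subr_eq0 => /eqP ->; rewrite horner_trunc series_sum.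
by apply: eq_bigr => m _; rewrite smapE seriesCM -rmorphXn.
Qed.

Lemma expdM r s n : (n < p)%N ->
  expd n (r * s) = \sum_(i < n.+1) expd i r * expd (n - i) s.
Proof.
move=> lt_np; transitivity (ev FR (smap (@seriesC R) (divpow r * divpow s)) iotal n).
  rewrite expdE //; apply: eq_bigr => m _; rewrite divpowM //.
rewrite rmorphM evM // seriesM; apply: eq_bigr => i _.
by rewrite !expdE //; [apply: leq_ltn_trans lt_np; apply: leq_subr
  |apply: leq_ltn_trans lt_np; rewrite -ltnS].
Qed.

Lemma expd0 r : expd 0 r = r.
Proof.
rewrite /expd (bigD1 (Ordinal p_gt0)) //= big1 ?addr0.
  by rewrite expr0 series1 rmorph1 mulr1 /divpow fact0 invr1 rmorph1 mul1r.
by case=> [[|i]] //= lt_ip _; rewrite cstcoefX l0 expr0n rmorph0 mulr0.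
Qed.

Lemma expd1 r : l 1%N = 1 -> expd 1 r = d r.
Proof.
move=> l1; rewrite /expd (bigD1 (Ordinal p_gt1)) //= big1 ?addr0.
  by rewrite expr1 l1 rmorph1 mulr1 /divpow factS fact0 muln1 invr1 rmorph1 mul1r.
have fl1 : fil (series_fil (discrete k)) 1 l by apply: fil_cstcoef.
case=> [[|[|i]]] //= lt_ip _; first by rewrite expr0 series1 rmorph0 mulr0.
by have /fil1E/(_ 1%N isT) -> := filX i.+2 fl1; rewrite rmorph0 mulr0.
Qed.

(** exp(l(X) d) exp(l(Y) d) = exp((l(X) + l(Y)) d) = exp(l(F(X,Y)) d): the first equality is
    [divpow2] together with d^p = 0, the second is the additivity of l modulo (X^p, Y^p). *)
Lemma expd_iter r i j : (i < p)%N -> (j < p)%N ->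
  expd i (expd j r) = \sum_(n < p) expd n r * iota (pow2 F n i j).
Proof.
move=> lt_ip lt_jp.
have divpow0 : divpow 0 = 0.
  by apply/funext => n; rewrite /divpow -(rmorph0 iota) -[iota 0]mul1r iter_derMc !rmorph0 !mulr0.
transitivity (\sum_(a < p) \sum_(b < p)
    divpow (divpow r b) a * iota ((l ^+ b) j) * iota ((l ^+ a) i)).
  rewrite {1}/expd; apply: eq_bigr => a _.
  rewrite /expd (big_morph divpow divpowD divpow0) series_sum mulr_suml.
  by apply: eq_bigr => b _; rewrite divpowMc.
rewrite (sum_triangle (f := fun a b => divpow (divpow r b) a *
  iota ((l ^+ b) j) * iota ((l ^+ a) i))); last first.
  by move=> a b le_p; rewrite divpow2_large // !mul0r.
transitivity (\sum_(m < p) divpow r m *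
    iota (\sum_(n < p) (l ^+ m) n * pow2 F n i j)).
  apply: eq_bigr => m _; rewrite (log_pow_additive fglF pchark l0 dl) //.
  rewrite rmorph_sum mulr_sumr; apply: eq_bigr => b _.
  rewrite divpow2 //; last by rewrite -ltnS.
  by rewrite rmorphMn rmorphM mulrnAr !mulrnAl -mulrA [iota _ * iota _]mulrC.
under eq_bigr => m _ do rewrite rmorph_sum mulr_sumr.
rewrite exchange_big; apply: eq_bigr => n _; rewrite /expd mulr_suml.
by apply: eq_bigr => m _; rewrite rmorphM mulrA.
Qed.

Lemma Fmderivation_expd :
  Fmderivation iota F (fun n : 'I_(p ^ 1) => expd n).
Proof.
have lt_p (n : 'I_(p ^ 1)) : (n < p)%N by rewrite -[X in (_ < X)%N]expn1.
split=> [n n0 r|r s n|r s n|c n|r i j].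
- by rewrite n0 expd0.
- by rewrite /expd divpowD -big_split; apply: eq_bigr => m _; rewrite mulrDl.
- by rewrite expdM // -(sum_pairs n (fun i j => expd i r * expd j s)).
- case: eqP => [->|/eqP n_neq0]; first exact: expd0.
  rewrite /expd big1 // => -[[|m] lt_mp] _ /=.
    by rewrite expr0 series1 (negPf n_neq0) rmorph0 mulr0.
  rewrite /divpow iterSr dC -(rmorph0 iota) -[iota 0]mul1r iter_derMc.
  by rewrite rmorph0 !(mulr0, mul0r).
- under [RHS]eq_bigr => n _ do rewrite tpow2E.
  by rewrite expd_iter // -!(big_mkord xpredT (fun n => expd n r * iota (pow2 F n i j))).
Qed.

End ExpDerivation.

(** * Rational functions *)

Lemma div_cross (K : fieldType) (a b c d : K) : b != 0 -> d != 0 ->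
  a / b = c / d -> a * d = c * b.
Proof. by move=> b0 d0 /eqP; rewrite eqr_div // => /eqP. Qed.

Lemma cross_div (K : fieldType) (a b c d : K) : b != 0 -> d != 0 ->
  a * d = c * b -> a / b = c / d.
Proof. by move=> b0 d0 E; apply/eqP; rewrite eqr_div // E. Qed.

Lemma quotient_rule (K : fieldType) (f b a' b' : K) : b != 0 ->
  (a' * b - f * b * b') / b ^+ 2 * b = a' - f * b'.
Proof. by move=> b0; field. Qed.

Lemma addf_cross (K : comNzRingType) (f g b d : K) :
  (f + g) * (b * d) = f * b * d + g * d * b.
Proof. by ring. Qed.

(** Here f = a/b and g = c/d, primes denote derivatives of numerators and denominators, and x, y are
    the derivatives of f, g, known through the quotient rule cleared of denominators. The same
    reading applies to [derivation_prod]. *)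
Lemma derivation_sum (K : comNzRingType) (f g a b c d x y a' b' c' d' : K) :
    f * b = a -> g * d = c -> x * b = a' - f * b' -> y * d = c' - g * d' ->
  a' * d + a * d' + (c' * b + c * b') - (f + g) * (b' * d + b * d') =
  (x + y) * (b * d).
Proof.
by move=> <- <- hx hy; rewrite (addf_cross x y b d) hx hy; ring.
Qed.

Lemma derivation_prod (K : comNzRingType) (f g a b c d x y a' b' c' d' : K) :
    f * b = a -> g * d = c -> x * b = a' - f * b' -> y * d = c' - g * d' ->
  a' * c + a * c' - f * g * (b' * d + b * d') =
  (x * g + f * y) * (b * d).
Proof.
move=> <- <- hx hy; transitivity ((x * b) * (g * d) + (f * b) * (y * d)).
  by rewrite hx hy; ring.
by ring.
Qed.

Section RationalFunctions.
Variable k : fieldType.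
Local Notation P := {poly k}.
Local Notation Q := {fraction {poly k}}.
Local Notation tofrac := (@tofrac {poly k}).
Local Notation iota := (ratfun_const k).

Lemma frac_num_den (f : Q) : f = tofrac (repr f).1 / tofrac (repr f).2.
Proof.
set r := repr f; have r_neq0 : tofrac r.2 != 0 by rewrite tofrac_eq0; apply: denom_ratioP.
apply: (canRL (mulfK r_neq0)); rewrite -[f]reprK -/r.
unlock FracField.tofrac; rewrite -[LHS]FracField.pi_mul; apply/eqmodP => /=.
rewrite FracField.equivfE /FracField.mulf !numden_Ratio ?oner_neq0 //.
- by rewrite !mulr1 mulrC.
- by rewrite mulr1; apply: denom_ratioP.
- by rewrite mulr1; apply: denom_ratioP.
Qed.

Definition fderiv (f : Q) : Q :=
  tofrac ((repr f).1^`() * (repr f).2 - (repr f).1 * (repr f).2^`())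
    / tofrac (repr f).2 ^+ 2.

(** Independence of the chosen fraction, obtained by differentiating the cross-multiplied relation
    between the two representatives. *)
Lemma fderivE (a b : P) : b != 0 ->
  fderiv (tofrac a / tofrac b) = tofrac (a^`() * b - a * b^`()) / tofrac b ^+ 2.
Proof.
move=> b_neq0; set f := tofrac a / tofrac b.
have := frac_num_den f; rewrite /fderiv.
have : (repr f).2 != 0 by apply: denom_ratioP.
move: (repr f).1 (repr f).2 => n d d_neq0 def_f.
have fb_neq0 : tofrac b != 0 by rewrite tofrac_eq0.
have fd_neq0 : tofrac d != 0 by rewrite tofrac_eq0.
have /eqP : tofrac (a * d) = tofrac (n * b).
  by rewrite 2!tofracM; apply: div_cross fb_neq0 fd_neq0 def_f.
rewrite tofrac_eq => /eqP ad_nb.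
apply: (cross_div (expf_neq0 2 fd_neq0) (expf_neq0 2 fb_neq0)).
rewrite -2!tofracXn.
rewrite -2!tofracM.
congr tofrac.
have := congr1 (@deriv k) ad_nb; rewrite !derivM => dE.
have n'b : n^`() * b = a^`() * d + a * d^`() - n * b^`() by rewrite dE addrK.
transitivity ((n^`() * b) * (d * b) - (n * b) * (d^`() * b)); first by ring.
rewrite n'b -ad_nb.
transitivity (a^`() * b * d ^+ 2 - (n * b) * (b^`() * d)); first by ring.
by rewrite -ad_nb; ring.
Qed.

Lemma frac_ex (f : Q) : exists a b, tofrac b != 0 /\ f * tofrac b = tofrac a.
Proof.
exists (repr f).1, (repr f).2.
have d_neq0 : tofrac (repr f).2 != 0 by rewrite tofrac_eq0; apply: denom_ratioP.
by split=> //; rewrite {1}(frac_num_den f); apply: (divfK d_neq0).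
Qed.

Lemma fderiv_quotient (f : Q) (a b : P) : tofrac b != 0 ->
  f * tofrac b = tofrac a ->
  fderiv f * tofrac b = tofrac a^`() - f * tofrac b^`().
Proof.
move=> fb_neq0 fb; have b_neq0 : b != 0 by rewrite -tofrac_eq0.
have def_f : f = tofrac a / tofrac b := canRL (mulfK fb_neq0) fb.
rewrite {1}def_f (fderivE _ b_neq0) tofracB 2!tofracM -fb.
exact: quotient_rule fb_neq0.
Qed.

Lemma fderivD : {morph fderiv : f g / f + g}.
Proof.
move=> f g; have [a [b [b_neq0 fb]]] := frac_ex f.
have [c [d [d_neq0 gd]]] := frac_ex g.
have bd_neq0 : tofrac (b * d) != 0 by rewrite tofracM; exact: (mulf_neq0 b_neq0 d_neq0).
have fg : (f + g) * tofrac (b * d) = tofrac (a * d + c * b).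
  by rewrite tofracD 3!tofracM -fb -gd; apply: addf_cross.
apply: (mulIf bd_neq0); rewrite (fderiv_quotient bd_neq0 fg) derivD 3!derivM.
rewrite 4!tofracD 7!tofracM.
exact: (derivation_sum fb gd (fderiv_quotient b_neq0 fb) (fderiv_quotient d_neq0 gd)).
Qed.

Lemma fderivM f g : fderiv (f * g) = fderiv f * g + f * fderiv g.
Proof.
have [a [b [b_neq0 fb]]] := frac_ex f.
have [c [d [d_neq0 gd]]] := frac_ex g.
have bd_neq0 : tofrac (b * d) != 0 by rewrite tofracM; exact: (mulf_neq0 b_neq0 d_neq0).
have fg : (f * g) * tofrac (b * d) = tofrac (a * c).
  by rewrite 2!tofracM -fb -gd; apply: mulrACA.
apply: (mulIf bd_neq0); rewrite (fderiv_quotient bd_neq0 fg) 2!derivM.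
rewrite 2!tofracD 5!tofracM.
exact: (derivation_prod fb gd (fderiv_quotient b_neq0 fb) (fderiv_quotient d_neq0 gd)).
Qed.

Lemma fderiv_tofrac (a : P) : fderiv (tofrac a) = tofrac a^`().
Proof.
have := @fderivE a 1 (oner_neq0 _).
by rewrite rmorph1 divr1 => ->; rewrite expr1n divr1 derivC mulr1 mulr0 subr0.
Qed.

Lemma fderivC c : fderiv (iota c) = 0.
Proof. by rewrite /= fderiv_tofrac derivC rmorph0. Qed.

End RationalFunctions.

(** * F-derivations on the projective line *)

Section FDerivations.
Variables (k : fieldType) (F : ps2 k) (p : nat).
Hypothesis fglF : formal_group_law F.
Hypothesis pchark : p \in [pchar k].
Variables (R : comNzRingType) (iota : {rmorphism k -> R}) (D : nat -> R -> R).
Hypothesis derD : Fderivation iota F D.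

Let unitF := fgl_unital fglF.

(** The two composites are governed by the coefficients of X Y^n and X^n Y in the powers of F, which
    depend on [omega] and on [rho] respectively. *)
Lemma Fder_comm1 n r : D 1 (D n r) = D n (D 1 r).
Proof.
rewrite !(fder_iter derD) addnC; apply: eq_bigr => m _.
by rewrite pow2_X1 // pow2_Y1 // (omega_rho fglF pchark).
Qed.

Lemma Fder1_mul r s : D 1 (r * s) = D 1 r * s + r * D 1 s.
Proof.
rewrite (fder_mul derD) /mul1 !big_ord_recl big_ord0 /= !(fder_id derD) addr0.
by rewrite addrC.
Qed.

Lemma Fder1_add : {morph D 1 : r s / r + s}.
Proof. by move=> r s; apply: fder_add derD _ _ _. Qed.

Lemma Fder_const n c : (0 < n)%N -> D n (iota c) = 0.
Proof. by move=> n_gt0; rewrite (fder_const derD) /const1 eqn0Ngt n_gt0. Qed.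

Lemma Fder_one n : (0 < n)%N -> D n 1 = 0.
Proof. by move=> n_gt0; rewrite -(rmorph1 iota) Fder_const. Qed.

Lemma Fder_opp n r : D n (- r) = - D n r.
Proof.
have D0 : D n 0 = 0 by apply: (addIr (D n 0)); rewrite -(fder_add derD) !add0r.
by apply: (addIr (D n r)); rewrite -(fder_add derD) !addNr.
Qed.

End FDerivations.

Section AdditiveSeries.
Variables (k : fieldType) (F : ps2 k) (p : nat).
Hypothesis fglF : formal_group_law F.
Hypothesis pchark : p \in [pchar k].
Local Notation nfold := (fgl_nfold F : nat -> series k).

(** Additivity gives b([p]_F) = p b = 0. As b is X times a series with constant term 1, and power
    series over k form a domain, [p]_F itself vanishes. *)
Lemma nfold_additive (b : series k) : b 0%N = 0 -> b 1%N = 1 ->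
  compose F b = seriesC b + atY k b -> nfold p = 0.
Proof.
move=> b0 b1 bF.
have sub_n n : subst (nfold n) b = b *+ n.
  elim: n => [|n IH].
    by rewrite nfold0 subst_shift // mul0r addr0 b0 rmorph0.
  have n0 := nfold_cst fglF n.
  by rewrite subst_nfoldS // bF subXYD // subXYC // subXY_atY // IH mulrSr.
have N0 := nfold_cst fglF p.
have := sub_n p; rewrite mulrn_pchar; last exact: series_pchar.
rewrite subst_shift // b0 rmorph0 add0r => /seriesM_eq0[//|] /(congr1 (@^~ 0%N)).
by rewrite /= subst_cstcoef // b1 series0 => /eqP; rewrite oner_eq0.
Qed.

End AdditiveSeries.

Lemma der_inverse (K : fieldType) (E : K -> K) (t : K) : t != 0 ->
    (forall r s, E (r * s) = E r * s + r * E s) -> E 1 = 0 -> E t = 1 ->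
  E t^-1 = - t^-1 ^+ 2.
Proof.
move=> t_neq0 EM E1 Et; have := EM t t^-1; rewrite divff // E1 Et mul1r => /esym/eqP.
rewrite addrC addr_eq0 => /eqP tE.
by rewrite -[LHS](mulKf t_neq0) tE expr2 mulrN.
Qed.

(** * Derivations near the point at infinity, in the coordinate x = 1/t *)

Section AtInfinity.
Variable k : fieldType.
Local Notation P := {poly k}.
Local Notation Q := {fraction {poly k}}.
Local Notation tofrac := (@tofrac {poly k}).
Local Notation iota := (ratfun_const k).
Local Notation T := (tofrac 'X).
Local Notation x := (T^-1).

Lemma fracX_neq0 : T != 0.
Proof. by rewrite tofrac_eq0 polyX_eq0. Qed.

(** g(1/t); the subalgebra [poly_inv_t] is the image of this map. *)
Definition evinv (g : P) : Q := (map_poly iota g).[x].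

Lemma evinvD g h : evinv (g + h) = evinv g + evinv h.
Proof. by rewrite /evinv rmorphD hornerD. Qed.
Lemma evinvN g : evinv (- g) = - evinv g.
Proof. by rewrite /evinv rmorphN hornerN. Qed.
Lemma evinvM g h : evinv (g * h) = evinv g * evinv h.
Proof. by rewrite /evinv rmorphM hornerM. Qed.
Lemma evinvC c : evinv c%:P = iota c.
Proof. by rewrite /evinv map_polyC hornerC. Qed.
Lemma evinvX : evinv 'X = x.
Proof. by rewrite /evinv map_polyX hornerX. Qed.
Lemma evinv0 : evinv 0 = 0.
Proof. by rewrite /evinv rmorph0 horner0. Qed.
Lemma evinv1 : evinv 1 = 1.
Proof. by rewrite /evinv rmorph1 hornerC. Qed.
Lemma evinv_sum (I : Type) (r : seq I) (S : pred I) (f : I -> P) :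
  evinv (\sum_(i <- r | S i) f i) = \sum_(i <- r | S i) evinv (f i).
Proof. exact: (big_morph _ evinvD evinv0). Qed.

(** r is the reciprocal polynomial of h. It brings questions about k[1/t] back to k[t], and its
    coefficient at t^d records the value of h(1/t) at infinity. *)
Lemma evinv_reverse (h : P) : exists d (r : P),
  [/\ (size r <= d.+1)%N, r`_d = h`_0 & T ^+ d * evinv h = tofrac r].
Proof.
elim/poly_ind: h => [|h c [d [r [sz_r r_d def_r]]]].
  by exists 0%N, 0; rewrite size_poly0 evinv0 mulr0 rmorph0.
exists d.+1, (r + c *: 'X^(d.+1)); split.
- rewrite (leq_trans (size_polyD _ _)) // geq_max (leq_trans sz_r) //=.
  by rewrite (leq_trans (size_scale_leq _ _)) // size_polyXn.
- rewrite coefD coefZ coefXn eqxx mulr1 coefD coefMX coefC /=.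
  by rewrite nth_default // addrC addr0 add0r.
rewrite evinvD evinvM evinvC evinvX mulrDr exprSr.
rewrite tofracD -def_r -mul_polyC tofracM tofracXn exprSr.
have cancel_T (K : fieldType) (t e : K) n : t != 0 -> t ^+ n * t * (e * t^-1) = t ^+ n * e.
  by move=> t0; field.
by rewrite (cancel_T _ _ _ _ fracX_neq0) [_ * iota c]mulrC.
Qed.

Lemma evinv_eq0 (h : P) : evinv h = 0 -> h`_0 = 0.
Proof.
have [d [r [_ <- def_r]]] := evinv_reverse h.
move=> h0; move: def_r; rewrite h0 mulr0 => /esym/eqP.
by rewrite tofrac_eq0 => /eqP ->; rewrite coef0.
Qed.

(** In the coordinate x = 1/t the derivation d/dt is - x^2 d/dx, with a double zero at infinity. *)
Lemma der_evinv (E : Q -> Q) (g : P) :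
    {morph E : r s / r + s} -> (forall r s, E (r * s) = E r * s + r * E s) ->
    (forall c, E (iota c) = 0) -> E T = 1 ->
  E (evinv g) = evinv (- ('X ^+ 2 * g^`())).
Proof.
move=> ED EM EC ET.
have E1 : E 1 = 0 by rewrite -(rmorph1 iota) EC.
have Ex := der_inverse fracX_neq0 EM E1 ET.
elim/poly_ind: g => [|g c IH].
  by rewrite deriv0 mulr0 oppr0 -[0]polyC0 evinvC EC rmorph0.
rewrite evinvD ED evinvC EC addr0 evinvM EM IH evinvX Ex -evinvX.
rewrite (expr2 (evinv 'X)) -(evinvM 'X 'X) -evinvN -2!evinvM -evinvD.
by congr evinv; rewrite derivD derivC derivM derivX; ring.
Qed.


(* E_1 commutes with E_n and maps k[1/t] into (1/t^2); applied to 1/t this shows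
   that the values of E_n(1/t) at infinity form a power series of square zero. *)
Lemma Fder_fixes_infinity (F : ps2 k) (p : nat) (E : nat -> Q -> Q) :
    formal_group_law F -> p \in [pchar k] -> Fderivation iota F E ->
    E 1%N T = 1 -> (forall n f, poly_inv_t f -> poly_inv_t (E n f)) ->
  forall n, exists h, E n x = x * evinv h.
Proof.
move=> fglF pchark derE ET Einv.
have /choice[g gP] n : exists g, E n x = evinv g.
  by apply: Einv; exists 'X; rewrite -[LHS]evinvX.
have EM := Fder1_mul derE; have ED := Fder1_add derE.
have EC c : E 1%N (iota c) = 0 by apply: Fder_const derE _ _ _.
have Ex := der_inverse fracX_neq0 EM (Fder_one derE (ltnSn 0)) ET.
pose gam : series k := fun n => (g n)`_0.
have gam2 : gam * gam = 0.
  apply/funext => n; rewrite series0 seriesM.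
  have : E 1%N (E n x) = E n (E 1%N x) := Fder_comm1 fglF pchark derE n x.
  rewrite gP (der_evinv _ ED EM EC ET) Ex (Fder_opp derE) expr2 (fder_mul derE).
  rewrite /mul1; under eq_bigr => i _ do rewrite !gP -evinvM.
  rewrite -evinv_sum -evinvN => /eqP; rewrite -subr_eq0 -evinvN -evinvD => /eqP.
  move/evinv_eq0; rewrite opprK coefD coefN -mulrA.
  rewrite coefXM eqxx oppr0 add0r coef_sum => sum0.
  by rewrite -[RHS]sum0; apply: eq_bigr => i _; rewrite coef0M.
have gam0 : gam = 0 by case: (seriesM_eq0 gam2).
move=> n; have gn0 : (g n)`_0 = 0 := congr1 (@^~ n) gam0.
exists (\poly_(i < size (g n)) (g n)`_i.+1).
rewrite gP -evinvX -evinvM; congr evinv; apply/polyP => i.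
rewrite coefXM coef_poly; case: i => [//|i] /=; case: ltnP => // le_i.
by rewrite nth_default // ltnW.
Qed.

(** Applying E_n to t x = 1 expresses E_n t through t, the E_i t with i < n and the E_j x with j >
    0. By induction the former are t times elements of k[x], and the latter are divisible by x, so
    E_n t has at most a simple pole at infinity. *)
Lemma Fder_affine (F : ps2 k) (E : nat -> Q -> Q) : Fderivation iota F E ->
    (forall n, exists h, E n x = x * evinv h) ->
  forall n, exists q, E n T = T * evinv q.
Proof.
move=> derE /choice[h hP] n; elim/ltn_ind: n => n IH.
case: (posnP n) => [->|n_gt0].
  by exists 1; rewrite evinv1 mulr1 (fder_id derE).
have Tx : T * x = 1 := divff fracX_neq0.
have := fder_mul derE T x n.
rewrite Tx (Fder_one derE n_gt0) /mul1 big_ord_recr /= subnn (fder_id derE) => E0.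
have : exists q, \sum_(i < n) E i T * E (n - i)%N x = evinv q.
  elim/big_ind: _ => [|_ _ [q1 ->] [q2 ->]|i _].
  - by exists 0; rewrite evinv0.
  - by exists (q1 + q2); rewrite evinvD.
  have [q ->] := IH i (ltn_ord i); rewrite hP; exists (q * h (n - i)%N).
  have cancel_T (K : comNzRingType) (t t' a b : K) :
    t * t' = 1 -> t * a * (t' * b) = a * b.
    by move=> tt'; rewrite mulrACA tt' mul1r.
  by rewrite evinvM; apply: cancel_T.
case=> q Eq; exists (- q).
have solve_T (K : comNzRingType) (t t' e a : K) :
    t * t' = 1 -> 0 = a + e * t' -> e = t * - a.
  move=> tt' ae; transitivity (e * (t * t') - t * (a + e * t')).
    by rewrite -ae mulr0 subr0 tt' mulr1.
  by ring.
by rewrite evinvN; apply: (solve_T _ _ _ _ _ Tx); rewrite -Eq.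
Qed.

(** A polynomial in t with at most a simple pole at infinity has degree at most 1. *)
Lemma size_affine (f q : P) : tofrac f = T * evinv q -> (size f <= 2)%N.
Proof.
move=> fq; have [d [r [sz_r _ def_r]]] := evinv_reverse q.
have [->|f_neq0] := eqVneq f 0; first by rewrite size_poly0.
have /eqP : tofrac ('X ^+ d * f) = tofrac ('X * r).
  by rewrite tofracM tofracXn fq tofracM -def_r mulrCA.
rewrite tofrac_eq => /eqP E; have := congr1 (fun g : P => size g) E.
rewrite /= -[_ * f]mulrC size_mulXn // mulrC => szE.
rewrite -(leq_add2l d) szE (leq_trans (size_polyMleq _ _)) // size_polyX.
by rewrite -[X in (_ + X).-1]/2%N !addn2 ltnS.
Qed.

End AtInfinity.

(** * The derivation d/dt: its exponential on the projective line, and its expansions *)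

Section TranslationDerivation.
Variables (k : fieldType) (F : ps2 k) (p : nat).
Hypothesis fglF : formal_group_law F.
Hypothesis pchark : p \in [pchar k].
Local Notation Q := {fraction {poly k}}.
Local Notation tofrac := (@tofrac {poly k}).
Local Notation iota := (ratfun_const k).

Lemma iter_deriv_pchar (f : {poly k}) : iter p (@deriv k) f = 0.
Proof.
have pcharP : p \in [pchar {poly k}] by rewrite pchar_poly.
rewrite -[LHS]/(f^`(p)) nderivn_def -mulr_natr.
have p_gt0 := prime_gt0 (pcharf_prime pchark).
have /dvdnP[c ->] : (p %| p`!)%N by rewrite dvdn_fact // p_gt0 leqnn.
by rewrite natrM (pcharf0 pcharP) !mulr0.
Qed.

Lemma iter_fderiv_tofrac n (f : {poly k}) :
  iter n (@fderiv k) (tofrac f) = tofrac (iter n (@deriv k) f).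
Proof. by elim: n => // n IH; rewrite !iterS IH fderiv_tofrac. Qed.

(** Multiplication by b^p, which is a constant for d/dt, clears the denominator and reduces to
    polynomials. *)
Lemma iter_fderiv_pchar (f : Q) : iter p (@fderiv k) f = 0.
Proof.
have [a [b [b_neq0 fb]]] := frac_ex f.
have bp0 : (b ^+ p)^`() = 0.
  have pcharP : p \in [pchar {poly k}] by rewrite pchar_poly.
  by rewrite deriv_exp -[LHS]mulr_natr (pcharf0 pcharP) mulr0.
have p_gt0 := prime_gt0 (pcharf_prime pchark).
have fbp : f * tofrac (b ^+ p) = tofrac (a * b ^+ p.-1).
  by rewrite -{1}(prednK p_gt0) exprS tofracM mulrA fb -tofracM.
have iter_bp n : iter n (@fderiv k) (f * tofrac (b ^+ p)) =
    iter n (@fderiv k) f * tofrac (b ^+ p).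
  elim: n => // n IH; rewrite !iterS IH fderivM fderiv_tofrac bp0 tofrac0.
  by rewrite mulr0 addr0.
have bp_neq0 : tofrac (b ^+ p) != 0.
  by rewrite tofracXn; exact: (expf_neq0 p b_neq0).
apply: (mulIf bp_neq0); rewrite -iter_bp fbp iter_fderiv_tofrac.
by rewrite iter_deriv_pchar tofrac0 mul0r.
Qed.

Lemma poly_inv_t_fderiv (f : Q) : poly_inv_t f -> poly_inv_t (fderiv f).
Proof.
case=> g ->; exists (- ('X ^+ 2 * g^`())); rewrite -[LHS]/(fderiv (evinv g)).
have fX : fderiv (tofrac 'X) = 1 by rewrite fderiv_tofrac derivX tofrac1.
exact: (der_evinv g (@fderivD k) (@fderivM k) (@fderivC k) fX).
Qed.

Lemma Fmderivation_P1_expd (l : series k) : l 0%N = 0 ->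
    (forall i, (i < p)%N -> invder F l i = (i == 0%N)%:R) ->
  Fmderivation_P1 F (fun n : 'I_(p ^ 1) => expd p l polyC (@deriv k) n).
Proof.
move=> l0 dl; split.
  apply: (Fmderivation_expd fglF pchark l0 dl (@derivD k) (@derivM k) (@derivC k)).
  exact: iter_deriv_pchar.
exists (fun n => expd p l iota (@fderiv k) n); split.
- exact: (Fmderivation_expd fglF pchark l0 dl (@fderivD k) (@fderivM k) (@fderivC k)
    iter_fderiv_pchar).
- move=> n f; rewrite /expd rmorph_sum; apply: eq_bigr => m _.
  rewrite /divpow iter_fderiv_tofrac. rewrite -[RHS]/(tofrac (_ * _ * _)).
  by rewrite 2!tofracM.
move=> n f f_inv; rewrite /expd.
have iter_inv m : poly_inv_t (iter m (@fderiv k) f).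
  by elim: m => // m IH; rewrite iterS; apply: poly_inv_t_fderiv.
elim/big_ind: _ => [|_ _ [g ->] [h ->]|m _].
- by exists 0; rewrite -[RHS]/(evinv 0) evinv0.
- by exists (g + h); exact: esym (evinvD g h).
have [g def_g] := iter_inv m.
exists ((m`!%:R^-1)%:P * g * ((l ^+ m) n)%:P).
by rewrite -[RHS]/(evinv _) 2!evinvM 2!evinvC /divpow def_g.
Qed.

Lemma expands_additive (D : nat -> {poly k} -> {poly k}) :
    Fderivation_P1 F D -> (forall f, D 1%N f = f^`()) ->
  has_height p F None.
Proof.
case=> derD [E [derE ED E_inv]] D1.
have ET : E 1%N (tofrac 'X) = 1 by rewrite ED D1 derivX tofrac1.
have infty := Fder_fixes_infinity fglF pchark derE ET E_inv.
have DnX n : (0 < n)%N -> exists b, D n 'X = b%:P.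
  move=> n_gt0; have [q Eq] := Fder_affine derE infty n.
  have sz2 : (size (D n 'X) <= 2)%N by apply: (@size_affine k _ q); rewrite -ED Eq.
  exists (D n 'X)`_0; apply: size1_polyC.
  (* The derivative of D_n t is D_1 D_n t = D_n D_1 t = D_n 1, which is 0 for n > 0. *)
  have d0 : (D n 'X)^`() = 0.
    have := Fder_comm1 fglF pchark derD n 'X.
    by rewrite !D1 derivX (Fder_one derD n_gt0).
  apply/leq_sizeP => -[//|[|j]] _; last by rewrite nth_default // (leq_trans sz2).
  by have := congr1 (fun g : {poly k} => g`_0) d0; rewrite coef_deriv coef0 mulr1n.
(* The value D_0 t = t is not a constant; 0 takes its place, in accordance with F^0 = 1 having no
   coefficient at X^i Y^j when i > 0. *)
pose b : series k := fun n => if n == 0%N then 0 else (D n 'X)`_0.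
have bE n : (0 < n)%N -> D n 'X = (b n)%:P.
  move=> n_gt0; have [c Dc] := DnX n n_gt0.
  by rewrite /b eqn0Ngt n_gt0 /= Dc coefC.
have unitF := fgl_unital fglF.
have b0 : b 0%N = 0 by [].
have bF : compose F b = seriesC b + atY k b.
  apply/funext => j; apply/funext => i; rewrite 2!seriesD seriesCE atYE seriesCE.
  case: (posnP j) => [->|j_gt0].
    by rewrite compose_Y0 // b0; case: ifP; rewrite addr0.
  rewrite series0 add0r; case: (posnP i) => [->|i_gt0]; first exact: compose_X0.
  rewrite (composeE unitF _ (ltnSn _)).
  (* For i, j > 0 the constant D_j t is killed by D_i, so the iteration rule states that the mixed
     coefficients of b(F(X,Y)) vanish. *)
  have := fder_iter derD 'X i j; rewrite (bE j j_gt0) (Fder_const derD _ i_gt0).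
  rewrite 2!big_ord_recl [b _]b0 mul0r add0r.
  have -> : pow2 F (@ord0 (i + j)) i j = 0.
    by rewrite -[LHS]/(one2 k i j) /one2 eqn0Ngt i_gt0.
  rewrite rmorph0 mulr0 add0r => sum0.
  apply: (polyC_inj); rewrite rmorph_sum /= polyC0 [RHS]sum0.
  by apply: eq_bigr => n _; rewrite (bE _ _) // rmorphM.
have b1 : b 1%N = 1 by rewrite /b /= D1 derivX coefC.
by move=> n; rewrite (nfold_additive fglF pchark b0 b1 bF) /const1; case: ifP.
Qed.

End TranslationDerivation.

Theorem corollary3p4 (k : fieldType) (p : nat) (pchark : p \in [pchar k])
  (perfectk : forall x : k, exists y : k, y ^+ p = x)
  (F : ps2 k) (fglF : formal_group_law F)
  (ht_neq1 : ~ has_height p F (Some 1%N))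
  (ht_neq_oo : ~ has_height p F None) :
  exists d : 'I_(p ^ 1) -> {poly k} -> {poly k},
    Fmderivation_P1 F d /\ ~ expands_P1 F d.
Proof.
have hp : fgl_nfold F p p = 0.
  apply/eqP; apply: contrapT => /negP hp; apply: ht_neq1.
  exact: has_height1 hp.
have [l [l0 l1 dl]] := exists_log fglF pchark hp.
exists (fun n => expd p l polyC (@deriv k) n); split.
  exact: Fmderivation_P1_expd.
case=> D [derD Dd]; apply: ht_neq_oo; apply: (expands_additive fglF pchark derD) => f.
have lt1p : (1 < p ^ 1)%N by rewrite expn1; exact: prime_gt1 (pcharf_prime pchark).
(* The X-coefficient of exp(l(X) d/dt) is l'(0) d/dt, and l is normalized by l'(0) = 1. *)
rewrite (Dd (Ordinal lt1p)) /=; apply: (expd1 pchark) => //.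
Qed.
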